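(* Let $n\ge 2$, let $\mathcal{H}=\mathcal{H}_1\otimes\cdots\otimes\mathcal{H}_n$ be a standard Hilbert module over $\mathbb{C}[z_1,\ldots,z_n]$, and let $\mathcal{Q}$ be a quotient module of $\mathcal{H}$. Then $$\mathcal{Q}=\mathcal{Q}_1\otimes\cdots\otimes\mathcal{Q}_n$$ for some quotient modules $\mathcal{Q}_i$ of $\mathcal{H}_i$, $i=1,\ldots,n$, if and only if (i) $\mathcal{Q}$ is doubly commuting, and (ii) for each $k=1,\ldots,n$, the subspace $[\mathcal{Q}]_{z_k,z_{k+1},\ldots,z_n}$ is a joint $(M_{z_k},M_{z_{k+1}},\ldots,M_{z_n})$-reducing subspace of $\mathcal{H}_1\otimes\cdots\otimes\mathcal{H}_n$.
   Context: Let $\mathbb{D}$ be the open unit disc in $\mathbb{C}$. A reproducing kernel Hilbert module over $\mathbb{C}[z]$ is a Hilbert space $\mathcal{H}$ of holomorphic functions on $\mathbb{D}$ with bounded point evaluations, containing the constant function $1$, on which multiplication by the coordinate, $M_z f=zf$, is a bounded operator $\mathcal{H}\to\mathcal{H}$. A closed subspace $\mathcal{S}\subseteq\mathcal{H}$ is a submodule if $M_z\mathcal{S}\subseteq\mathcal{S}$; a closed subspace $\mathcal{Q}$ is a quotient module if $\mathcal{Q}^\perp$ is a submodule. $\mathcal{H}$ is a standard Hilbert module over $\mathbb{C}[z]$ if there do not exist two non-zero quotient modules of $\mathcal{H}$ orthogonal to each other. A standard Hilbert module over $\mathbb{C}[z_1,\ldots,z_n]$ is a Hilbert space tensor product $\mathcal{H}=\mathcal{H}_1\otimes\cdots\otimes\mathcal{H}_n$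 of standard Hilbert modules $\mathcal{H}_i$ over $\mathbb{C}[z]$, with module multiplication operators $M_{z_i}=I_{\mathcal{H}_1}\otimes\cdots\otimes M_z\otimes\cdots\otimes I_{\mathcal{H}_n}$ ($M_z$ in the $i$-th place). A closed subspace $\mathcal{S}\subseteq\mathcal{H}$ is a submodule if $M_{z_i}\mathcal{S}\subseteq\mathcal{S}$ for all $i$; a closed subspace $\mathcal{Q}$ is a quotient module if $\mathcal{Q}^\perp$ is a submodule. For a quotient module put $C_{z_i}=P_{\mathcal{Q}}M_{z_i}|_{\mathcal{Q}}$, where $P_{\mathcal{Q}}$ is the orthogonal projection onto $\mathcal{Q}$; $\mathcal{Q}$ is doubly commuting if $C_{z_i}C_{z_j}^*=C_{z_j}^*C_{z_i}$ for all $1\le i<j\le n$. For $1\le k\le n$, $[\mathcal{Q}]_{z_k,\ldots,z_n}$ is the smallest closed joint $(M_{z_k},\ldots,M_{z_n})$-invariant subspace containing $\mathcal{Q}$, i.e. the closed linear span of $M_{z_k}^{l_k}\cdots M_{z_n}^{l_n}\mathcal{Q}$ over all integers $l_k,\ldots,l_n\ge 0$. A closed subspace is joint reducing for a tuple of operators if it is invariant under each operator of the tuple and under its adjoint. *)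

(* Defs.v *)
From HB Require Import structures.
From mathcomp Require Import all_boot all_order all_algebra sesquilinear complex.
From mathcomp Require Import all_classical all_reals all_analysis.

Set Implicit Arguments.
Unset Strict Implicit.
Unset Printing Implicit Defensive.

Import Order.TTheory GRing.Theory Num.Theory.
Import numFieldNormedType.Exports.

Local Open Scope classical_set_scope.
Local Open Scope ring_scope.
Local Open Scope complex_scope.

(* The inner product is linear in its first argument. The norm of a normed
   module over R[i] takes its values in the nonnegative reals of R[i]. *)
HB.mixin Record isHilbert (R : realType) H of CompleteNormedModule R[i] H := {
  inner : {dot H for @Num.conj R[i]} ;
  innerE : forall x : H, inner x x = `|x| ^+ 2
}.

#[short(type="hilbertType")]
HB.structure Definition Hilbert (R : realType) :=
  { H of CompleteNormedModule R[i] H & isHilbert R H }.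

Definition bounded_op (R : realType) (V W : normedModType R[i]) (T : V -> W) :=
  exists c : R, forall x, `|T x| <= c%:C * `|x|.

(* [eval f] is the function on the unit disc underlying the vector [f]; its
   values outside the disc carry no information. *)
HB.mixin Record isRKHilbertModule (R : realType) H of Hilbert R H := {
  eval : H -> R[i]^o -> R[i]^o ;
  eval_linear : forall z : R[i], `|z| < 1 -> linear (eval ^~ z) ;
  eval_inj : forall f g : H,
    (forall z : R[i], `|z| < 1 -> eval f z = eval g z) -> f = g ;
  eval_holomorphic : forall (f : H) (z : R[i]), `|z| < 1 ->
    derivable (eval f) z 1 ;
  eval_bounded : forall z : R[i], `|z| < 1 -> bounded_op (eval ^~ z) ;
  eval_one : exists e : H, forall z : R[i], `|z| < 1 -> eval e z = 1 ;
  mulz : {linear H -> H} ;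
  mulzE : forall (f : H) (z : R[i]), `|z| < 1 -> eval (mulz f) z = z * eval f z ;
  mulz_bounded : bounded_op mulz
}.

#[short(type="rkHilbertModuleType")]
HB.structure Definition RKHilbertModule (R : realType) :=
  { H of Hilbert R H & isRKHilbertModule R H }.

Section HilbertSpace.
Context {R : realType} {H : hilbertType R}.
Implicit Types (S G : set H) (T : H -> H).

Definition closed_subspace S :=
  [/\ S 0, forall (a : R[i]) x y, S x -> S y -> S (a *: x + y) & closed S].

Definition closed_span G : set H := smallest closed_subspace G.

Definition orthocomp S : set H := [set x | forall y, S y -> inner x y = 0].

Definition proj S (x : H) : H := xget 0 [set p | S p /\ orthocomp S (x - p)].

(* P_S T restricted to S; only its values on S matter. *)
Definition compression S T : H -> H := fun x => proj S (T x).

(* The adjoint of an operator [T] on the closed subspace [S], as an operator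
   on [S]; [adjoint_on setT T] is the adjoint of [T] on the whole space. *)
Definition adjoint_on S T (y : H) : H :=
  xget 0 [set w | S w /\ forall x, S x -> inner (T x) y = inner x w].

Section Tuples.
Context {I : Type}.
Implicit Type M : I -> H -> H.

Definition submodule M S := closed_subspace S /\ forall i, M i @` S `<=` S.

Definition quotient_module M Q :=
  closed_subspace Q /\ submodule M (orthocomp Q).

(* [J] selects the operators of the tuple that are considered. *)
Definition invariant_hull M (J : set I) G : set H :=
  smallest [set S | closed_subspace S /\ forall i, J i -> M i @` S `<=` S] G.

Definition joint_reducing M (J : set I) S :=
  closed_subspace S /\
  forall i, J i -> M i @` S `<=` S /\ adjoint_on setT (M i) @` S `<=` S.

End Tuples.

Definition doubly_commuting n (M : 'I_n -> H -> H) (Q : set H) :=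
  forall i j : 'I_n, (i < j)%N -> forall x, Q x ->
    let C k := compression Q (M k) in
    C i (adjoint_on Q (C j) x) = adjoint_on Q (C j) (C i x).

End HilbertSpace.

Definition quotient_module1 (R : realType) (H : rkHilbertModuleType R)
    (Q : set H) :=
  quotient_module (fun _ : unit => mulz : H -> H) Q.

Definition standard (R : realType) (H : rkHilbertModuleType R) :=
  ~ exists Q1 Q2 : set H,
      [/\ quotient_module1 Q1 /\ Q1 <> [set 0],
          quotient_module1 Q2 /\ Q2 <> [set 0] &
          forall x y, Q1 x -> Q2 y -> inner x y = 0].

(* [K], with [tens x] in the role of x_1 (x) ... (x) x_n, is the Hilbert space
   tensor product of the [H i]: these data determine [K] up to a unique unitary
   operator intertwining the maps [tens]. *)
Record hilbert_tensor (R : realType) n (H : 'I_n -> hilbertType R)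
    (K : hilbertType R) (tens : (forall i, H i) -> K) : Prop := HilbertTensor {
  tens_linear : forall (x : forall i, H i) (i : 'I_n),
    linear (fun u : H i => tens (eqtype.dfwith x u)) ;
  tens_inner : forall x y : forall i, H i,
    inner (tens x) (tens y) = \prod_(i < n) inner (x i) (y i) ;
  tens_total : closed_span (range tens) = setT
}.

(* [M i] is I (x) ... (x) M_z (x) ... (x) I, with M_z in position [i]: the
   bounded operator determined by its values on elementary tensors. *)
Record hilbert_module_tensor (R : realType) n (H : 'I_n -> rkHilbertModuleType R)
    (K : hilbertType R) (tens : (forall i, H i) -> K)
    (M : 'I_n -> {linear K -> K}) : Prop := HilbertModuleTensor {
  module_tensor : @hilbert_tensor R n H K tens ;
  module_bounded : forall i, bounded_op (M i) ;
  module_tens : forall i (x : forall i, H i),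
    M i (tens x) = tens (eqtype.dfwith x (mulz (x i)))
}.

Definition tensor_subspace (R : realType) n (H : 'I_n -> hilbertType R)
    (K : hilbertType R) (tens : (forall i, H i) -> K)
    (S : forall i, set (H i)) : set K :=
  closed_span (tens @` [set x | forall i, S i (x i)]).

(* Main.v *)
Require Import Defs.
From HB Require Import structures.
From mathcomp Require Import all_boot all_order all_algebra sesquilinear complex.
From mathcomp Require Import all_classical all_reals all_analysis.
From mathcomp Require Import ring lra.

(** Write M_i for multiplication by the i-th coordinate and N_i for its
    adjoint.

    Suppose first that Q is the product of quotient modules Q_i. The
    compression of M_i to Q is the compression of M_z to Q_i acting on the i-th
    factor, so compressions and adjoints for different factors commute
    ([tensor_doubly_commuting]). In a standard module a non-zero quotient
    module generates everything: the complement of the submodule it generates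
    is a quotient module orthogonal to it. So the hull of Q under some of the
    coordinates replaces the corresponding Q_i by H_i (unless Q vanishes), and
    it is reducing ([hull_tensor], [tensor_reducing]).

    Conversely, let Q be doubly commuting with reducing hulls, and let Q_i be
    its support in H_i, the smallest closed subspace such that Q lies in H_1
    (x) ... (x) Q_i (x) ... (x) H_n. The point is to show that Q splits off
    each factor: it is invariant under B (x) 1 for all operators B on Q_i
    ([regular]). A subspace that splits off all factors but one is a tensor
    product ([tensor_of_regular]), so the first n - 1 factors suffice.

    The tool is a Schur lemma ([commutant_scalar]). If A is self-adjoint and
    commutes on an N-invariant subspace with N, then the kernel of A and its
    complement are orthogonal N-invariant subspaces, one of which vanishes by
    standardness. So the commutant has no zero divisors among its self-adjoint
    elements, and the factorization (A + |A|) (A - |A|) = 0 makes A a scalar.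
    The absolute value |A| is obtained by a norm convergent iteration. Applied
    to the coefficients along H_i of the projection onto a subspace S, the
    lemma shows that S splits off the i-th factor as soon as S reduces the
    compression of M_i to the support of S in H_i ([regular_of_reducing]).

    Assume that Q splits off the factors before the i-th, and let S be its hull
    under the coordinates after the i-th. As S is reducing, it splits off the
    later factors by the Schur lemma, and it inherits the earlier ones from Q;
    hence S is the product of Q_1, ..., Q_i and of the full later factors. By
    double commutation, the difference D of the compressions of M_i to S and to
    Q commutes with N_j for j > i. Its values are orthogonal to Q, thus to S,
    and they lie in S, so D = 0 ([proj_hull_compression]). Therefore Q reduces
    the compression of M_i to Q_i and splits off the i-th factor
    ([regular_support_step]). *)

Set Implicit Arguments.
Unset Strict Implicit.
Unset Printing Implicit Defensive.

Import Order.TTheory GRing.Theory Num.Theory.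
Import numFieldNormedType.Exports.

Local Open Scope classical_set_scope.
Local Open Scope ring_scope.
Local Open Scope complex_scope.

Local Notation proj := Defs.proj.
Local Notation upd := eqtype.dfwith.

(** * Inner products and bounded operators *)

Section InnerProduct.
Context {R : realType} {H : hilbertType R}.
Implicit Types (x y z : H) (a : R[i]) (S : set H).

Lemma innerDl x y z : inner (x + y) z = inner x z + inner y z.
Proof. exact: linearDl. Qed.

Lemma innerBl x y z : inner (x - y) z = inner x z - inner y z.
Proof. exact: linearBl. Qed.

Lemma innerZl a x z : inner (a *: x) z = a * inner x z.
Proof. exact: linearZl_LR. Qed.

Lemma inner0l z : inner 0 z = 0.
Proof. exact: linear0l. Qed.

Lemma innerDr x y z : inner z (x + y) = inner z x + inner z y.
Proof. exact: linearDr. Qed.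

Lemma innerBr x y z : inner z (x - y) = inner z x - inner z y.
Proof. exact: linearBr. Qed.

Lemma innerZr a x z : inner z (a *: x) = Num.conj a * inner z x.
Proof. exact: linearZr_LR. Qed.

Lemma inner0r z : inner z 0 = 0.
Proof. exact: linear0r. Qed.

Lemma innerNl x z : inner (- x) z = - inner x z.
Proof. exact: linearNl. Qed.

Lemma innerNr x z : inner z (- x) = - inner z x.
Proof. exact: linearNr. Qed.

Lemma innerC x y : inner x y = Num.conj (inner y x).
Proof. by rewrite (hermC (inner : {dot H for @Num.conj R[i]})) expr0 mul1r. Qed.

Lemma inner_sym0 x y : inner x y = 0 -> inner y x = 0.
Proof. by rewrite [inner y x]innerC => ->; rewrite rmorph0. Qed.

Lemma inner_ge0 x : 0 <= inner x x.
Proof. by rewrite innerE exprn_ge0. Qed.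

Lemma inner_eq0 x : (inner x x == 0) = (x == 0).
Proof. by rewrite innerE sqrf_eq0 normr_eq0. Qed.

Lemma inner_ext x y : (forall z, inner x z = inner y z) -> x = y.
Proof.
move=> e; apply/eqP; rewrite -subr_eq0 -inner_eq0 innerBl.
by rewrite e subrr.
Qed.

Lemma inner_extr x y : (forall z, inner z x = inner z y) -> x = y.
Proof. by move=> e; apply: inner_ext => z; rewrite innerC e -innerC. Qed.

Lemma cauchy_schwarz x y : `|inner x y| <= `|x| * `|y|.
Proof.
have [->|y0] := eqVneq y 0; first by rewrite inner0r normr0 mulr_ge0.
have yy0 : 0 < inner y y by rewrite lt_neqAle inner_ge0 eq_sym inner_eq0 y0.
rewrite -(ler_pXn2r (n := 2)) ?nnegrE ?mulr_ge0 // exprMn -!innerE.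
have : 0 <= inner (x - (inner x y / inner y y) *: y)
                  (x - (inner x y / inner y y) *: y) by exact: inner_ge0.
rewrite innerBl !innerBr !innerZl !innerZr rmorphM fmorphV /= -!innerC.
have -> : inner x x - inner y x / inner y y * inner x y -
    (inner x y / inner y y * inner y x -
     inner x y / inner y y * (inner y x / inner y y * inner y y)) =
    inner x x - (inner x y * inner y x) / inner y y.
  by field; rewrite gt_eqF.
by rewrite subr_ge0 ler_pdivrMr // normCK -innerC.
Qed.

End InnerProduct.

(** A predicate on bare functions, because composites, sums, limits and adjoints
    of operators all arise as bare functions. *)
Definition blin (R : realType) (V W : normedModType R[i]) (T : V -> W) :=
  linear T /\ bounded_op T.

Section BoundedLinear.
Context {R : realType}.
Local Notation C := R[i].

Section Linear.
Context {V W : lmodType C} {T : V -> W}.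
Hypothesis lT : linear T.

Lemma lin0 : T 0 = 0.
Proof. by have := lT (-1) 0 0; rewrite scaler0 addr0 scaleN1r addNr. Qed.

Lemma linD x y : T (x + y) = T x + T y.
Proof. by have := lT 1 x y; rewrite !scale1r. Qed.

Lemma linZ a x : T (a *: x) = a *: T x.
Proof. by have := lT a x 0; rewrite lin0 !addr0. Qed.

Lemma linN x : T (- x) = - T x.
Proof. by rewrite -scaleN1r linZ scaleN1r. Qed.

Lemma linB x y : T (x - y) = T x - T y.
Proof. by rewrite linD linN. Qed.

End Linear.

Section Bounded.
Context {V W : normedModType C}.
Implicit Types (T U : V -> W).

Lemma bounded_op_gt0 T : bounded_op T ->
  exists2 c : R, 0 < c & forall x, `|T x| <= c%:C * `|x|.
Proof.
move=> [c Tc]; exists (`|c| + 1); first by rewrite ltr_wpDl.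
move=> x; apply: le_trans (Tc x) _; apply: ler_wpM2r => //.
by rewrite lecR; apply: le_trans (ler_norm c) _; rewrite lerDl.
Qed.

Lemma blin_continuous T : blin T -> continuous T.
Proof.
move=> [lT bT].
pose T' : {linear V -> W} := HB.pack T (GRing.isLinear.Build _ _ _ _ T lT).
suff : continuous T' by [].
apply/linear_bounded_continuous/linear_boundedP.
have [c c0 Tc] := bounded_op_gt0 bT.
exists c%:C; split; first by apply/complex_realP; exists c.
move=> M cM x; apply: le_trans (Tc x) _; apply: ler_wpM2r => //.
exact: ltW.
Qed.

Lemma blin_closed T (A : set W) : blin T -> closed A -> closed (T @^-1` A).
Proof.
by move=> bT cA; apply: closed_comp => // x _; exact: blin_continuous.
Qed.

Lemma blinD T U : blin T -> blin U -> blin (fun x => T x + U x).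
Proof.
move=> [lT [c Tc]] [lU [d Ud]]; split.
  by move=> a x y; rewrite lT lU scalerDr addrACA.
exists (c + d) => x; rewrite rmorphD mulrDl.
exact: le_trans (ler_normD _ _) (lerD _ _).
Qed.

Lemma blinZ T a : blin T -> blin (fun x => a *: T x).
Proof.
move=> [lT bT]; split; first by move=> b x y; rewrite lT scalerDr !scalerA mulrC.
have [c c0 Tc] := bounded_op_gt0 bT.
exists (complex.Re `|a| * c) => x.
rewrite normrZ rmorphM /= (RRe_real (normr_real a)) -mulrA.
by apply: ler_wpM2l.
Qed.

Lemma blinB T U : blin T -> blin U -> blin (fun x => T x - U x).
Proof.
move=> bT bU.
have -> : (fun x => T x - U x) = (fun x => T x + (-1) *: U x).
  by apply/funext => x; rewrite scaleN1r.
by apply: blinD => //; exact: blinZ.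
Qed.

End Bounded.

Lemma blin_comp {U V W : normedModType C} (T : V -> W) (S : U -> V) :
  blin T -> blin S -> blin (T \o S).
Proof.
move=> [lT bT] [lS bS]; split; first by move=> a x y; rewrite /= lS lT.
have [c c0 Tc] := bounded_op_gt0 bT; have [d d0 Sd] := bounded_op_gt0 bS.
exists (c * d) => x /=; apply: le_trans (Tc _) _.
by rewrite rmorphM /= -mulrA ler_wpM2l // ler0c ltW.
Qed.

Lemma blin_id {V : normedModType C} : blin (@idfun V).
Proof. by split=> //; exists 1 => x; rewrite mul1r. Qed.

End BoundedLinear.

Section InnerContinuity.
Context {R : realType} {H : hilbertType R}.
Local Notation C := R[i].

Lemma blin_innerl (y : H) : blin (fun x => inner x y : C^o).
Proof.
split; first by move=> a u v; rewrite innerDl innerZl.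
exists (complex.Re `|y|) => x; rewrite (RRe_real (normr_real y)) mulrC.
exact: cauchy_schwarz.
Qed.

End InnerContinuity.

Section ClosedSubspace.
Context {R : realType} {H : hilbertType R}.
Local Notation C := R[i].
Implicit Types (S G : set H) (x y : H).

Lemma subspace0 S : closed_subspace S -> S 0.
Proof. by case. Qed.

Lemma subspaceD S x y : closed_subspace S -> S x -> S y -> S (x + y).
Proof. by case=> _ h _ Sx Sy; rewrite -[x]scale1r; exact: h. Qed.

Lemma subspaceZ S a x : closed_subspace S -> S x -> S (a *: x).
Proof. by case=> S0 h _ Sx; rewrite -[_ *: _]addr0; exact: h. Qed.

Lemma subspaceB S x y : closed_subspace S -> S x -> S y -> S (x - y).
Proof.
by move=> cS Sx Sy; rewrite -scaleN1r; apply: subspaceD => //; apply: subspaceZ.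
Qed.

Lemma closed_subspaceT : closed_subspace [set: H].
Proof. by split=> //; exact: closedT. Qed.

Lemma closed_set0 (V : normedModType C) : closed [set (0 : V)].
Proof.
exact: accessible_closed_set1 (hausdorff_accessible (@norm_hausdorff _ _)) _.
Qed.

Lemma closed_subspace_set0 : closed_subspace [set (0 : H)].
Proof.
split=> //; last exact: closed_set0.
by move=> a x y -> ->; rewrite scaler0 addr0.
Qed.

Lemma closed_subspaceI S G :
  closed_subspace S -> closed_subspace G -> closed_subspace (S `&` G).
Proof.
move=> [S0 SD cS] [G0 GD cG]; split=> //; last exact: closedI.
by move=> a x y [Sx Gx] [Sy Gy]; split; [apply: SD|apply: GD].
Qed.

Lemma closed_subspace_preim (K : hilbertType R) (T : K -> H) S :
  blin T -> closed_subspace S -> closed_subspace (T @^-1` S).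
Proof.
move=> bT [S0 SD cS]; split; last exact: blin_closed.
- by rewrite /preimage /= (lin0 bT.1).
- by move=> a x y Sx Sy; rewrite /preimage /= bT.1; exact: SD.
Qed.

Lemma closed_subspace_ker (V : normedModType C) (T : H -> V) :
  blin T -> closed_subspace [set x | T x = 0].
Proof.
move=> bT; split; first exact: lin0 bT.1.
  by move=> a x y /= Tx Ty; rewrite bT.1 Tx Ty scaler0 addr0.
exact: (@blin_closed _ _ _ T [set 0] bT (@closed_set0 V)).
Qed.

Lemma closed_subspace_orthocomp G : closed_subspace (orthocomp G).
Proof.
split; first by move=> y _; rewrite inner0l.
  move=> a x y ox oy z Gz; rewrite innerDl innerZl ox // oy //.
  by rewrite mulr0 addr0.
have -> : orthocomp G = \bigcap_(y in G) ((fun x => inner x y : C^o) @^-1` [set 0]).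
  by apply/seteqP; split=> x ox y Gy; exact: ox.
apply: closed_bigI => y _; apply: blin_closed; first exact: blin_innerl.
exact: closed_set0.
Qed.

Lemma closed_span_sub G : G `<=` closed_span G.
Proof. exact: sub_gen_smallest. Qed.

Lemma closed_span_min G S : closed_subspace S -> G `<=` S -> closed_span G `<=` S.
Proof. by move=> cS GS; apply: smallest_sub. Qed.

Lemma closed_subspace_bigI {I : Type} (D : set I) (F : I -> set H) :
  (forall i, D i -> closed_subspace (F i)) ->
  closed_subspace (\bigcap_(i in D) F i).
Proof.
move=> cF; split.
- by move=> i Di; exact: subspace0 (cF i Di).
- move=> a x y Fx Fy i Di; have [_ h _] := cF i Di.
  by apply: h; [exact: Fx|exact: Fy].
- by apply: closed_bigI => i Di; case: (cF i Di).
Qed.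

Lemma closed_subspace_span G : closed_subspace (closed_span G).
Proof.
by apply: (@closed_subspace_bigI _ _ id) => S [].
Qed.

End ClosedSubspace.

(** * Orthogonal projections and adjoints *)

Section Completeness.
Context {R : realType} {H : hilbertType R}.
Implicit Types (x : H) (f : nat -> H).

Lemma normr_Re x : (complex.Re `|x|)%:C = `|x|.
Proof. exact: RRe_real (normr_real x). Qed.

Lemma cvg_seqP f (l : H) : f @ \oo --> l <->
  forall e : R, 0 < e -> exists N, forall n, (N <= n)%N -> `|l - f n| <= e%:C.
Proof.
split=> [/cvgrPdist_le fl e e0|fl].
  have e0' : 0 < e%:C by rewrite ltcR.
  by have [N _ Nf] := fl _ e0'; exists N.
apply/cvgrPdist_le => e e0.
have eE : e = (complex.Re e)%:C by rewrite RRe_real ?gtr0_real.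
have [|N Nf] := fl (complex.Re e); first by rewrite -ltcR -eE.
by exists N => // n /= /Nf; rewrite -eE.
Qed.

Lemma cauchy_seq_cvg f :
  (forall e : R, 0 < e -> exists N, forall m n,
     (N <= m)%N -> (N <= n)%N -> `|f m - f n| <= e%:C) ->
  cvgn f.
Proof.
move=> fc; apply: cauchy_cvg; apply/cauchy_ballP => e e0.
have eE : e = (complex.Re e)%:C by rewrite RRe_real ?gtr0_real.
have e20 : 0 < complex.Re e / 2 by rewrite divr_gt0 // -ltcR -eE.
have [N Nf] := fc _ e20.
exists ([set y | exists2 n, (N <= n)%N & f n = y],
        [set y | exists2 n, (N <= n)%N & f n = y]).
  by split; exists N => // n /= Nn; exists n.
move=> [_ _] [[m Nm <-] [n Nn <-]] /=; rewrite -ball_normE /=.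
apply: le_lt_trans (Nf _ _ Nm Nn) _.
by rewrite [ltRHS]eE ltcR; lra.
Qed.

Lemma norm_lim_le (f : nat -> H) (l : H) (c : R[i]) : f @ \oo --> l ->
  (forall n, `|f n| <= c) -> `|l| <= c.
Proof.
move=> /cvg_seqP fl fc.
have c0 : 0 <= c := le_trans (normr_ge0 _) (fc 0%N).
have cE : (complex.Re c)%:C = c by rewrite RRe_real // ger0_real.
rewrite -cE -normr_Re lecR; apply/ler_addgt0Pr => e e0.
have [N Nf] := fl e e0.
rewrite -lecR rmorphD /= normr_Re cE -(subrK (f N) l) addrC.
by apply: le_trans (ler_normD _ _) (lerD _ _) => //; exact: Nf.
Qed.

Lemma norm_le_all_eq0 (b : R) (a : R[i]) :
  (forall e : R, 0 < e -> `|a| <= (e * b)%:C) -> a = 0.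
Proof.
move=> ab; apply/normr0_eq0.
have aE : (complex.Re `|a|)%:C = `|a| by rewrite RRe_real // normr_real.
rewrite -aE; congr (_%:C); apply/eqP; rewrite eq_le -(ler0c (complex.Re _)) aE.
rewrite normr_ge0 andbT; apply/ler_addgt0Pr => e e0; rewrite add0r.
have b0 : 0 < `|b| + 1 by rewrite ltr_wpDl.
have := ab (e / (`|b| + 1)); rewrite divr_gt0 // => /(_ isT).
rewrite -aE lecR => /le_trans; apply.
rewrite -mulrA ler_piMr ?(ltW e0) // mulrC ler_pdivrMr // mul1r.
by apply: le_trans (ler_norm b) _; rewrite lerDl.
Qed.

End Completeness.

Section Projection.
Context {R : realType} {H : hilbertType R}.
Implicit Types (S G : set H) (x y z : H).

Lemma parallelogram x y :
  `|x + y| ^+ 2 + `|x - y| ^+ 2 = 2 * (`|x| ^+ 2 + `|y| ^+ 2).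
Proof. by rewrite -!innerE !innerDl !innerNl !innerDr !innerNr; ring. Qed.

(** Moving [z] inside [S] along y by the coefficient of [x - z] on y lowers the
    squared distance to [x] by |<x - z, y>|^2 / |y|^2, and the infimum d leaves
    room for at most e^2. *)
Lemma near_minimizer_orthogonal S x z (d e : R) : closed_subspace S -> 0 <= e ->
    (forall s, S s -> d%:C <= `|x - s| ^+ 2) -> S z ->
    `|x - z| ^+ 2 <= (d + e ^+ 2)%:C ->
  forall y, S y -> `|inner (x - z) y| <= e%:C * `|y|.
Proof.
move=> cS e0 dS Sz ze y Sy.
have [->|y0] := eqVneq y 0; first by rewrite inner0r !normr0 mulr0.
have yy0 : 0 < inner y y by rewrite lt_neqAle inner_ge0 eq_sym inner_eq0 y0.
rewrite -(ler_pXn2r (n := 2)) ?nnegrE ?mulr_ge0 // ?ler0c // exprMn -[`|y| ^+ 2]innerE.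
have : forall a, d%:C <= `|(x - z) - a *: y| ^+ 2.
  move=> a; rewrite -addrA -opprD; apply: dS; apply: subspaceD => //.
  exact: subspaceZ.
move: (x - z) ze => w ze; pose t := inner w y / inner y y => /(_ t).
have tC : Num.conj t = inner y w / inner y y.
  by rewrite rmorphM fmorphV /= -!innerC.
rewrite -innerE innerBl !innerBr !innerZl !innerZr tC.
have -> : inner w w - inner y w / inner y y * inner w y -
    (t * inner y w - t * (inner y w / inner y y * inner y y)) =
    inner w w - (inner w y * inner y w) / inner y y.
  by rewrite /t; field; rewrite gt_eqF.
rewrite -innerE in ze; move=> dw.
rewrite normCK -innerC -ler_pdivrMr //.
have := le_trans dw (lerB ze (lexx _)).
by rewrite rmorphD rmorphXn /= lerBrDr lerD2l.
Qed.

(** A minimizing sequence for the distance is Cauchy by the parallelogram law, as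
    the midpoints of its terms lie in [S]. *)
Theorem projection_exists S x : closed_subspace S ->
  exists p, S p /\ orthocomp S (x - p).
Proof.
move=> cS.
have [q nE] : exists q : H -> R, forall s, (q s)%:C = `|x - s| ^+ 2.
  exists (fun s => complex.Re (`|x - s| ^+ 2)) => s.
  by rewrite RRe_real // ger0_real // exprn_ge0.
pose D := [set q s | s in S].
have infD : has_inf D.
  split; first by exists (q 0), 0 => //; exact: subspace0.
  by exists 0 => _ [s _ <-]; rewrite -ler0c nE exprn_ge0.
set d := inf D.
have dS s : S s -> d%:C <= `|x - s| ^+ 2.
  move=> Ss; rewrite -nE lecR; apply: ge_inf; first exact: infD.2.
  by exists s.
have minz (e : R) : 0 < e -> exists z, S z /\ `|x - z| ^+ 2 <= (d + e ^+ 2)%:C.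
  move=> e0; have [_ [z Sz <-] zd] := inf_adherent (exprn_gt0 2 e0) infD.
  by exists z => //; rewrite -nE lecR ltW.
pose eps n : R := n.+1%:R^-1.
have eps0 n : 0 < eps n by rewrite invr_gt0.
have [s sP] := choice (fun n => minz _ (eps0 n)).
have sS n : S (s n) := (sP n).1.
have sd n : `|x - s n| ^+ 2 <= (d + eps n ^+ 2)%:C := (sP n).2.
have sc : cvgn s.
  apply: cauchy_seq_cvg => e e0.
  have e20 : 0 < e / 2 by rewrite divr_gt0.
  have [N _ Ne] := near_infty_natSinv_lt (PosNum e20).
  exists N => m n Nm Nn.
  rewrite -(ler_pXn2r (n := 2)) ?nnegrE ?ler0c ?(ltW e0) //.
  have small k : (N <= k)%N -> eps k ^+ 2 <= e ^+ 2 / 4.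
    move=> Nk; have -> : e ^+ 2 / 4 = (e / 2) ^+ 2 by field.
    rewrite ler_pXn2r ?nnegrE ?ltW //.
    by exact: Ne.
  have mid : S (2^-1 *: (s m + s n)).
    by apply: subspaceZ => //; exact: subspaceD.
  have := parallelogram (x - s m) (x - s n).
  have -> : x - s m + (x - s n) = 2 *: (x - 2^-1 *: (s m + s n)).
    rewrite scalerBr scalerA divff ?pnatr_eq0 // scale1r scaler_nat mulr2n.
    by rewrite opprD addrACA.
  have -> : x - s m - (x - s n) = s n - s m.
    by rewrite opprB addrC addrA subrK.
  rewrite normrZ exprMn normr_nat => eq4.
  have -> : `|s m - s n| ^+ 2 = 2 * (`|x - s m| ^+ 2 + `|x - s n| ^+ 2) -
      4 * `|x - 2^-1 *: (s m + s n)| ^+ 2.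
    by rewrite [X in X ^+ 2 = _]distrC -eq4; ring.
  have -> : 2 * (`|x - s m| ^+ 2 + `|x - s n| ^+ 2) -
      4 * `|x - 2^-1 *: (s m + s n)| ^+ 2 =
      (2 * (q (s m) + q (s n)) - 4 * q (2^-1 *: (s m + s n)))%:C.
    by rewrite rmorphB !rmorphM !rmorph_nat rmorphD /= !nE.
  have -> : e%:C ^+ 2 = (e ^+ 2)%:C by rewrite rmorphXn.
  rewrite lecR.
  have := dS _ mid; have := sd m; have := sd n.
  rewrite -!nE !lecR; have := small m Nm; have := small n Nn.
  lra.
have Sp : S (lim (s @ \oo)).
  have [_ _ clS] := cS; apply: (closed_cvg S clS _ _ sc).
  by exists 0%N => // n _; exact: sS.
exists (lim (s @ \oo)); split=> // y Sy.
apply: (@norm_le_all_eq0 _ (2 * complex.Re `|y|)) => e e0.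
have /cvg_seqP sl := sc.
have [N sN] := sl _ e0; have [M _ Me] := near_infty_natSinv_lt (PosNum e0).
set p := lim _ in sN *; pose n := maxn N M.
have -> : x - p = (x - s n) + (s n - p) by rewrite addrA subrK.
rewrite innerDl; apply: le_trans (ler_normD _ _) _.
have -> : (e * (2 * complex.Re `|y|))%:C = e%:C * `|y| + e%:C * `|y|.
  by rewrite -mulrDl -rmorphD mulrA rmorphM /= normr_Re mulr_natr mulr2n.
apply: lerD.
  have : eps n <= e by apply/ltW/Me; exact: leq_maxr.
  move=> ne; apply: le_trans (_ : (eps n)%:C * `|y| <= _).
    exact: near_minimizer_orthogonal cS (ltW (eps0 n)) dS (sS n) (sd n) _ Sy.
  by rewrite ler_wpM2r ?lecR.
apply: le_trans (cauchy_schwarz _ _) _; rewrite ler_wpM2r // distrC.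
by apply: sN; exact: leq_maxl.
Qed.

Lemma projP S x : closed_subspace S -> S (proj S x) /\ orthocomp S (x - proj S x).
Proof.
move=> cS; exact: (@xgetPex _ 0 [set p | S p /\ orthocomp S (x - p)])
  (projection_exists x cS).
Qed.

Lemma proj_in S x : closed_subspace S -> S (proj S x).
Proof. by move=> /(projP x)[]. Qed.

Lemma proj_orth S x y : closed_subspace S -> S y -> inner (x - proj S x) y = 0.
Proof. by move=> /(projP x)[_]; exact. Qed.

Lemma subB_sub x y z : (x - y) - (x - z) = z - y.
Proof. by rewrite opprB addrC addrA subrK. Qed.

Lemma proj_unique S x p : closed_subspace S -> S p -> orthocomp S (x - p) ->
  proj S x = p.
Proof.
move=> cS Sp op; apply/eqP; rewrite -subr_eq0 -inner_eq0.
have Sd : S (proj S x - p) by apply: subspaceB => //; exact: proj_in.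
by rewrite -{1}(subB_sub x) innerBl op // proj_orth // subrr.
Qed.

Lemma proj_id S x : closed_subspace S -> S x -> proj S x = x.
Proof.
by move=> cS Sx; apply: proj_unique => // y _; rewrite subrr inner0l.
Qed.

Lemma proj_eq0 S x : closed_subspace S -> orthocomp S x -> proj S x = 0.
Proof.
by move=> cS ox; apply: proj_unique => //; [exact: subspace0|rewrite subr0].
Qed.

Lemma inner_projl S x y : closed_subspace S -> S y -> inner (proj S x) y = inner x y.
Proof.
by move=> cS Sy; apply/eqP; rewrite eq_sym -subr_eq0 -innerBl proj_orth.
Qed.

Lemma inner_projr S x y : closed_subspace S -> S x -> inner x (proj S y) = inner x y.
Proof. by move=> cS Sx; rewrite innerC inner_projl // -innerC. Qed.

Lemma proj_selfadj S x y : closed_subspace S ->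
  inner (proj S x) y = inner x (proj S y).
Proof.
move=> cS; rewrite -(inner_projr y cS (proj_in x cS)).
by rewrite inner_projl //; exact: proj_in.
Qed.

Lemma proj_linear S : closed_subspace S -> linear (proj S).
Proof.
move=> cS a x y; apply: inner_ext => z.
by rewrite proj_selfadj // !innerDl !innerZl !proj_selfadj.
Qed.

Lemma blin_proj S : closed_subspace S -> blin (proj S).
Proof.
move=> cS; split; first exact: proj_linear.
exists 1 => x; rewrite mul1r.
have [->|p0] := eqVneq (proj S x) 0; first by rewrite normr0.
have := cauchy_schwarz x (proj S x).
rewrite -(inner_projl x cS (proj_in x cS)) innerE normrX normr_id expr2.
by rewrite ler_pM2r // normr_gt0.
Qed.

Lemma orthocompK S : closed_subspace S -> orthocomp (orthocomp S) = S.
Proof.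
move=> cS; apply/seteqP; split=> [x ox|x Sx y oy]; last exact: inner_sym0 (oy _ Sx).
suff -> : x = proj S x by exact: proj_in.
apply/eqP; rewrite -subr_eq0 -inner_eq0 innerBl ox; last by case: (projP x cS).
by rewrite sub0r inner_sym0 ?oppr0 // proj_orth //; exact: proj_in.
Qed.

Lemma orthocomp_eq0 S : closed_subspace S -> orthocomp S `<=` [set 0] -> S = setT.
Proof.
move=> cS oS; rewrite -(orthocompK cS); apply/seteqP; split=> // x _ y /oS ->.
by rewrite inner0r.
Qed.

End Projection.

Section Adjoint.
Context {R : realType}.
Local Notation C := R[i].

(** A vector orthogonal to the kernel of [phi] represents [phi] up to a scalar. *)
Theorem riesz (H : hilbertType R) (phi : H -> C^o) : blin phi ->
  exists w, forall x, phi x = inner x w.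
Proof.
move=> bphi; have lphi := bphi.1; have cker := closed_subspace_ker bphi.
have [phi0|/existsNP[x0 /eqP phix0]] := pselect (forall x, phi x = 0).
  by exists 0 => x; rewrite phi0 inner0r.
set S := [set x | phi x = 0] in cker.
pose z := x0 - proj S x0.
have phiz : phi z = phi x0.
  have phip : phi (proj S x0) = 0 := proj_in x0 cker.
  by rewrite /z (linB lphi) phip subr0.
have zz0 : inner z z != 0.
  rewrite inner_eq0; apply: contra_neq phix0 => z0.
  by rewrite -phiz z0 (lin0 lphi).
exists (Num.conj (phi z / inner z z) *: z) => x.
rewrite innerZr conjCK.
have : inner z (phi z *: x - phi x *: z) = 0.
  apply: proj_orth => //; rewrite /S /= (linB lphi) !(linZ lphi) /=.
  by rewrite /GRing.scale /= mulrC subrr.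
move/inner_sym0; rewrite innerBl !innerZl => /eqP; rewrite subr_eq0 => /eqP xz.
by rewrite mulrAC xz mulfK.
Qed.

(** Defined by choice, like [adjoint_on], but also for operators between two
    different spaces; [adjP] is its characteristic property. *)
Definition adj (V W : hilbertType R) (T : V -> W) (y : W) : V :=
  xget 0 [set w | forall x, inner (T x) y = inner x w].

Section AdjointTheory.
Context {V W : hilbertType R}.
Implicit Types (T : V -> W).

Lemma adjP T x y : blin T -> inner (T x) y = inner x (adj T y).
Proof.
move=> bT.
have := riesz (blin_comp (blin_innerl y) bT).
by move=> /(@xgetPex _ 0 [set w | forall x, inner (T x) y = inner x w])/(_ x).
Qed.

Lemma adjPr T x y : blin T -> inner x (T y) = inner (adj T x) y.
Proof. by move=> bT; rewrite innerC adjP // -innerC. Qed.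

Lemma adj_unique T (T' : W -> V) : blin T ->
  (forall x y, inner (T x) y = inner x (T' y)) -> adj T = T'.
Proof.
move=> bT TT'; apply/funext => y; apply: inner_extr => x.
by rewrite -adjP.
Qed.

Lemma blin_adj T : blin T -> blin (adj T).
Proof.
move=> bT; split.
  move=> a x y; apply: inner_extr => z.
  by rewrite -adjP // !innerDr !innerZr !adjP.
have [c c0 Tc] := bounded_op_gt0 bT.2; exists c => y.
have [->|p0] := eqVneq (adj T y) 0; first by rewrite normr0 mulr_ge0 // ler0c ltW.
rewrite -(ler_pM2r (x := `|adj T y|)) ?normr_gt0 // -expr2 -innerE -adjP //.
rewrite -[leLHS]ger0_norm; last by rewrite adjP // inner_ge0.
apply: le_trans (cauchy_schwarz _ _) _.
by rewrite mulrAC ler_wpM2r.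
Qed.

End AdjointTheory.

Lemma adj_comp (U V W : hilbertType R) (T : V -> W) (S : U -> V) :
  blin T -> blin S -> adj (T \o S) = adj S \o adj T.
Proof.
move=> bT bS; apply: adj_unique; first exact: blin_comp.
by move=> x y /=; rewrite !adjP.
Qed.

Context {H : hilbertType R}.
Implicit Types (S : set H) (T : H -> H).

Lemma adjoint_on_unique S T y w : closed_subspace S -> S w ->
  (forall x, S x -> inner (T x) y = inner x w) -> adjoint_on S T y = w.
Proof.
move=> cS Sw Tw; rewrite /adjoint_on.
set D := [set w | _].
have [Sx xP] : D (xget 0 D) by apply: (@xgetPex _ 0 D); exists w.
apply/eqP; rewrite -subr_eq0 -inner_eq0 {1}innerBl.
have Sd : S (xget 0 D - w) by exact: subspaceB.
rewrite -innerBl innerBr -xP // -Tw // subrr.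
by [].
Qed.

Lemma adjoint_on_setT T : blin T -> adjoint_on setT T = adj T.
Proof.
move=> bT; apply/funext => y.
by apply: (adjoint_on_unique closed_subspaceT I) => x _; exact: adjP.
Qed.

Lemma orthocomp_invariant S T : blin T ->
  (forall x, S x -> S (T x)) ->
  forall x, orthocomp S x -> orthocomp S (adj T x).
Proof. by move=> bT ST x ox y Sy; rewrite -adjPr //; apply: ox; exact: ST. Qed.

Lemma orthocomp_adj_invariant S T : blin T ->
  (forall x, S x -> S (adj T x)) ->
  forall x, orthocomp S x -> orthocomp S (T x).
Proof. by move=> bT ST x ox y Sy; rewrite adjP //; apply: ox; exact: ST. Qed.

End Adjoint.

(** * The absolute value of a self-adjoint contraction *)

Section AbsoluteValue.
Context {R : realType} {H : hilbertType R}.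
Local Notation C := R[i].

Definition selfadj (A : H -> H) := forall x y, inner (A x) y = inner x (A y).

Variable A : H -> H.
Hypotheses (bA : blin A) (sA : selfadj A) (contrA : forall x, `|A x| <= `|x|).

(** The equation 2 Y = (1 - A^2) + Y^2 means (1 - Y)^2 = A^2; its solution
    Y = 1 - |A| is found by iterating it from 0. The numbers [bnd n] follow the
    same recursion with A = 0. They dominate the norms of the iterates and of
    their differences, and they converge since they increase and are at most 1. *)
Fixpoint iter_op n : H -> H :=
  if n is m.+1
  then fun x => 2^-1 *: (x - A (A x) + iter_op m (iter_op m x))
  else fun=> 0.

Fixpoint bnd n : R := if n is m.+1 then (1 + bnd m ^+ 2) / 2 else 0.

Lemma bnd_ge0_le1 n : 0 <= bnd n <= 1.
Proof.
elim: n => [|n /andP[b0 b1]] /=; first by rewrite lexx ler01.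
have : bnd n ^+ 2 <= 1 by rewrite expr_le1.
have := sqr_ge0 (bnd n); lra.
Qed.

Lemma bnd_leS n : bnd n <= bnd n.+1.
Proof. by rewrite /=; have := sqr_ge0 (1 - bnd n); rewrite sqrrB; lra. Qed.

Lemma blin_iter_op n : blin (iter_op n).
Proof.
elim: n => [|n IH] /=.
  split; first by move=> a x y; rewrite scaler0 addr0.
  by exists 0 => x; rewrite normr0 mul0r.
apply: (blinZ (T := fun x => x - A (A x) + iter_op n (iter_op n x))).
apply: (blinD (T := fun x => x - A (A x))); last exact: blin_comp.
by apply: (blinB (T := idfun)); [exact: blin_id|exact: blin_comp].
Qed.

Lemma iter_op_selfadj n : selfadj (iter_op n).
Proof.
elim: n => [|n IH] x y /=; first by rewrite inner0l inner0r.
rewrite innerZl innerZr !innerDl !innerDr innerNl innerNr !sA !IH.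
by rewrite fmorphV rmorph_nat.
Qed.

Lemma contr_sqr_compl x : `|x - A (A x)| <= `|x|.
Proof.
rewrite -(ler_pXn2r (n := 2)) ?nnegrE // -!innerE innerBl !innerBr.
rewrite !(sA (A x)) -[inner x (A (A x))]sA.
have : inner (A (A x)) (A (A x)) <= inner (A x) (A x).
  by rewrite !innerE ler_pXn2r ?nnegrE.
have : 0 <= inner (A x) (A x) by exact: inner_ge0.
rewrite (sA (A x) (A (A x))) => a0 a1.
have -> : inner x x - inner (A x) (A x) -
    (inner (A x) (A x) - inner (A x) (A (A (A x)))) =
    inner x x - (inner (A x) (A x) +
    (inner (A x) (A x) - inner (A x) (A (A (A x))))) by ring.
by rewrite gerBl addr_ge0 // subr_ge0.
Qed.

Lemma iter_op_le n x : `|iter_op n x| <= (bnd n)%:C * `|x|.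
Proof.
elim: n x => [|n IH] x /=; first by rewrite normr0 mul0r.
rewrite normrZ ger0_norm ?invr_ge0 ?ler0n // mulrC ler_pdivrMr //.
have -> : ((1 + bnd n ^+ 2) / 2)%:C * `|x| * 2 =
          `|x| + (bnd n)%:C * ((bnd n)%:C * `|x|).
  rewrite rmorphM rmorphD rmorphXn fmorphV /= rmorph1 rmorph_nat.
  by field.
apply: le_trans (ler_normD _ _) _; apply: lerD; first exact: contr_sqr_compl.
apply: le_trans (IH _) _; rewrite ler_wpM2l // ler0c.
by case/andP: (bnd_ge0_le1 n).
Qed.

(** Commutation is assumed on an invariant subspace [S] only: the Schur lemma
    below compares operators on a subspace of their domain. *)
Section Commutation.
Variables (T : H -> H) (S : set H).
Hypotheses (lT : linear T) (cS : closed_subspace S).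
Hypotheses (AS : forall x, S x -> S (A x))
  (AT : forall x, S x -> A (T x) = T (A x)).

Lemma iter_op_commute n x : S x -> S (iter_op n x) /\
  iter_op n (T x) = T (iter_op n x).
Proof.
elim: n x => [|n IH] x Sx /=; first by split; [exact: subspace0|rewrite (lin0 lT)].
have [Sy Ty] := IH _ Sx; have [Syy Tyy] := IH _ Sy; split.
  apply: subspaceZ => //; apply: subspaceD => //.
  by apply: subspaceB => //; apply: AS; exact: AS.
by rewrite Ty Tyy (linZ lT) (linD lT) (linB lT) !AT //; exact: AS.
Qed.

End Commutation.

Lemma iter_op_comm_A n x : iter_op n (A x) = A (iter_op n x).
Proof. 
by have [] := @iter_op_commute A setT bA.1 closed_subspaceT (fun _ _ => I)
  (fun _ _ => erefl) n x I.
Qed.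

Lemma iter_op_comm n m x : iter_op n (iter_op m x) = iter_op m (iter_op n x).
Proof.
by have [] := @iter_op_commute _ setT (blin_iter_op m).1 closed_subspaceT
  (fun _ _ => I) (fun y _ => esym (iter_op_comm_A m y)) n x I.
Qed.

(** The iterates commute, so Y_(n+2) - Y_(n+1) is half the product of
    Y_(n+1) + Y_n and Y_(n+1) - Y_n; the numbers [bnd n] satisfy the same
    identity. *)
Lemma iter_op_step n x :
  `|iter_op n.+1 x - iter_op n x| <= (bnd n.+1 - bnd n)%:C * `|x|.
Proof.
elim: n x => [|n IH] x.
  by rewrite /= !subr0 addr0 -/(iter_op 1) -/(bnd 1);
     have := iter_op_le 1 x; rewrite /= addr0.
have e k : iter_op k.+1 x = 2^-1 *: (x - A (A x) + iter_op k (iter_op k x)) by [].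
have -> : iter_op n.+2 x - iter_op n.+1 x =
    2^-1 *: (iter_op n.+1 (iter_op n.+1 x - iter_op n x) +
             iter_op n (iter_op n.+1 x - iter_op n x)).
  rewrite (linB (blin_iter_op n.+1).1) (linB (blin_iter_op n).1).
  rewrite [iter_op n (iter_op n.+1 x)]iter_op_comm addrA subrK e.
  by rewrite [X in _ - X]e -scalerBr opprD addrACA subrr add0r.
rewrite normrZ ger0_norm ?invr_ge0 ?ler0n // mulrC ler_pdivrMr //.
have -> : (bnd n.+2 - bnd n.+1)%:C * `|x| * 2 =
   (bnd n.+1)%:C * ((bnd n.+1 - bnd n)%:C * `|x|) +
   (bnd n)%:C * ((bnd n.+1 - bnd n)%:C * `|x|).
  have eb : bnd n.+2 - bnd n.+1 = (bnd n.+1 + bnd n) * (bnd n.+1 - bnd n) / 2.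
    have bS k : bnd k.+1 = (1 + bnd k ^+ 2) / 2 by [].
    by rewrite bS [X in _ - X = _]bS; field.
  rewrite eb rmorphM fmorphV /= rmorph_nat rmorphM rmorphD /=.
  by field.
have b0 k : 0 <= (bnd k)%:C by rewrite ler0c; case/andP: (bnd_ge0_le1 k).
apply: le_trans (ler_normD _ _) _; apply: lerD.
  by apply: le_trans (iter_op_le _ _) _; rewrite ler_wpM2l.
by apply: le_trans (iter_op_le _ _) _; rewrite ler_wpM2l.
Qed.

Lemma iter_op_diff n k x :
  `|iter_op (n + k) x - iter_op n x| <= (bnd (n + k) - bnd n)%:C * `|x|.
Proof.
elim: k => [|k IH]; first by rewrite addn0 !subrr normr0 mul0r.
rewrite addnS.
have -> : iter_op (n + k).+1 x - iter_op n x =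
  (iter_op (n + k).+1 x - iter_op (n + k) x) + (iter_op (n + k) x - iter_op n x).
  by rewrite addrA subrK.
have -> : (bnd (n + k).+1 - bnd n)%:C * `|x| =
  (bnd (n + k).+1 - bnd (n + k))%:C * `|x| + (bnd (n + k) - bnd n)%:C * `|x|.
  by rewrite -mulrDl -rmorphD addrA subrK.
exact: le_trans (ler_normD _ _) (lerD (iter_op_step _ _) IH).
Qed.

Lemma bnd_cvg : cvgn bnd.
Proof.
apply: nondecreasing_is_cvgn.
  by apply/nondecreasing_seqP; exact: bnd_leS.
by exists 1 => _ [n _ <-]; case/andP: (bnd_ge0_le1 n).
Qed.

Lemma iter_op_cvg x : cvgn (fun n => iter_op n x).
Proof.
apply: cauchy_seq_cvg => e e0.
have x0 : 0 < complex.Re `|x| + 1 by rewrite ltr_wpDl // -ler0c normr_Re.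
have d0 : 0 < e / (complex.Re `|x| + 1) / 2 by rewrite !divr_gt0.
have /cvgrPdist_lt/(_ _ d0)[N _ Nb] := bnd_cvg.
exists N => m n Nm Nn.
suff key p q : (N <= p)%N -> (p <= q)%N -> `|iter_op q x - iter_op p x| <= e%:C.
  have [mn|nm] := leqP m n; last by apply: key => //; exact: ltnW.
  by rewrite distrC; exact: key.
move=> Np pq; rewrite -(subnKC pq); apply: le_trans (iter_op_diff _ _ _) _.
rewrite subnKC // -[`|x|]normr_Re -rmorphM lecR.
have /= dp := Nb p Np; have /= dq := Nb q (leq_trans Np pq).
have : bnd q - bnd p <= e / (complex.Re `|x| + 1).
  have := ler_distD (limn bnd) (bnd q) (bnd p).
  move=> /(le_trans (ler_norm _)) /le_trans; apply.
  rewrite [X in X + _]distrC [leRHS]splitr.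
  by apply: lerD; exact: ltW.
rewrite ler_pdivlMr // => h; apply: le_trans h; rewrite mulrDr mulr1.
have : bnd p <= bnd q.
  by move/nondecreasing_seqP: bnd_leS; exact.
lra.
Qed.

(** The limit 1 - |A|. *)
Definition abs_compl x : H := lim ((fun n => iter_op n x) @ \oo).
Local Notation Y := abs_compl.

Lemma abs_compl_lin : linear Y.
Proof.
move=> a x y; apply: (@cvg_lim H); first exact: norm_hausdorff.
have -> : (fun n => iter_op n (a *: x + y)) =
          (fun n => a *: iter_op n x + iter_op n y).
  by apply/funext => n; rewrite (blin_iter_op n).1.
by apply: cvgD; [apply: cvgZr|]; exact: iter_op_cvg.
Qed.

Lemma abs_compl_le x : `|Y x| <= `|x|.
Proof.
apply: (norm_lim_le (@iter_op_cvg x)) => n; apply: le_trans (iter_op_le _ _) _.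
rewrite ler_piMl // -(rmorph1 (real_complex R)) lecR.
by case/andP: (bnd_ge0_le1 n).
Qed.

Lemma blin_abs_compl : blin Y.
Proof.
by split; [exact: abs_compl_lin|exists 1 => x; rewrite mul1r; exact: abs_compl_le].
Qed.

Lemma abs_compl_selfadj : selfadj Y.
Proof.
move=> x y; apply/eqP; rewrite -subr_eq0; apply/eqP.
apply: (@norm_le_all_eq0 _ (complex.Re (`|x| + `|y|))) => e e0.
have /cvg_seqP/(_ e e0)[N Nx] := @iter_op_cvg x.
have /cvg_seqP/(_ e e0)[M My] := @iter_op_cvg y.
pose n := maxn N M.
have -> : inner (Y x) y - inner x (Y y) =
  inner (Y x - iter_op n x) y - inner x (Y y - iter_op n y).
  by rewrite innerBl innerBr iter_op_selfadj; ring.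
have -> : (e * complex.Re (`|x| + `|y|))%:C = e%:C * `|y| + `|x| * e%:C.
  by rewrite rmorphM /= RRe_real ?ger0_real ?addr_ge0 //; ring.
apply: le_trans (ler_normB _ _) _; apply: lerD.
  apply: le_trans (cauchy_schwarz _ _) _; rewrite ler_wpM2r //.
  by apply: Nx; exact: leq_maxl.
apply: le_trans (cauchy_schwarz _ _) _; rewrite ler_wpM2l //.
by apply: My; exact: leq_maxr.
Qed.

Lemma abs_compl_commute (T : H -> H) (S : set H) :
  blin T -> closed_subspace S ->
  (forall x, S x -> S (A x)) ->
  (forall x, S x -> A (T x) = T (A x)) ->
  forall x, S x -> S (Y x) /\ Y (T x) = T (Y x).
Proof.
move=> bT cS AS AT x Sx; split.
  have [_ _ clS] := cS; apply: (closed_cvg S clS _ _ (@iter_op_cvg x)).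
  by exists 0%N => // n _; have [] := iter_op_commute bT.1 cS AS AT n Sx.
apply: (@cvg_lim H); first exact: norm_hausdorff.
have -> : (fun n => iter_op n (T x)) = T \o (fun n => iter_op n x).
  by apply/funext => n /=; have [] := iter_op_commute bT.1 cS AS AT n Sx.
apply: continuous_cvg; last exact: iter_op_cvg.
exact: blin_continuous.
Qed.

Lemma abs_compl_comm_A x : Y (A x) = A (Y x).
Proof. 
by have [] := @abs_compl_commute A setT bA closed_subspaceT (fun _ _ => I)
  (fun _ _ => erefl) x I.
Qed.

Lemma abs_compl_eq x : 2 *: Y x = x - A (A x) + Y (Y x).
Proof.
suff : Y x = 2^-1 *: (x - A (A x) + Y (Y x)).
  by move=> {1}->; rewrite scalerA divff ?pnatr_eq0 // scale1r.
apply: (@cvg_lim H); first exact: norm_hausdorff.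
rewrite -cvg_shiftS; apply: cvgZr; apply: cvgD; first exact: cvg_cst.
apply/cvg_seqP => e e0.
have e20 : 0 < e / 2 by rewrite divr_gt0.
have /cvg_seqP/(_ _ e20)[N Nx] := @iter_op_cvg x.
have /cvg_seqP/(_ _ e20)[M My] := @iter_op_cvg (Y x).
exists (maxn N M) => n; rewrite geq_max => /andP[/Nx xn /My yn].
rewrite -/(Y _) in xn yn.
have -> : Y (Y x) - iter_op n (iter_op n x) =
  (Y (Y x) - iter_op n (Y x)) + iter_op n (Y x - iter_op n x).
  by rewrite (linB (blin_iter_op n).1) addrA subrK.
rewrite [e]splitr rmorphD; apply: le_trans (ler_normD _ _) (lerD yn _).
apply: le_trans xn; apply: le_trans (iter_op_le _ _) _.
rewrite ler_piMl // -(rmorph1 (real_complex R)) lecR.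
by case/andP: (bnd_ge0_le1 n).
Qed.

(** The absolute value |A|. *)
Definition absop x : H := x - Y x.

Lemma absop_sqr x : absop (absop x) = A (A x).
Proof.
rewrite /absop (linB abs_compl_lin).
have -> : x - Y x - (Y x - Y (Y x)) = x - 2 *: Y x + Y (Y x).
  by rewrite opprB addrA addrAC scaler_nat mulr2n opprD !addrA.
by rewrite abs_compl_eq opprD addrA subrK opprB addrC subrK.
Qed.

(** If <|A| x, x> = 0 then <Y x, x> = |x|^2, the equality case of Cauchy-Schwarz
    for the contraction Y = 1 - |A|; hence Y x = x. *)
Lemma absop_form_eq0 x : inner (absop x) x = 0 -> absop x = 0.
Proof.
rewrite /absop innerBl => /eqP; rewrite subr_eq0 eq_sym => /eqP Yx.
apply/eqP; rewrite -inner_eq0 eq_le inner_ge0 andbT.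
rewrite innerBl !innerBr Yx -[inner x (Y x)]abs_compl_selfadj Yx subrr sub0r.
rewrite opprB subr_le0 !innerE ler_pXn2r ?nnegrE //.
exact: abs_compl_le.
Qed.

End AbsoluteValue.

(** * A Schur lemma without eigenvectors *)

(** The orthogonal subspaces [U1] and [U2] need not be complementary in [W], so the
    property passes from [W] to its subspaces; irreducibility in the sense of
    reducing subspaces would not. *)
Definition irreducible_on (R : realType) (H : hilbertType R) (N : H -> H)
    (W : set H) :=
  forall U1 U2 : set H, closed_subspace U1 -> closed_subspace U2 ->
    U1 `<=` W -> U2 `<=` W ->
    (forall x, U1 x -> U1 (N x)) -> (forall x, U2 x -> U2 (N x)) ->
    (forall x y, U1 x -> U2 y -> inner x y = 0) ->
    U1 `<=` [set 0] \/ U2 `<=` [set 0].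

Section Schur.
Context {R : realType} {H : hilbertType R}.
Local Notation C := R[i].

Variables (N : H -> H) (W : set H).
Hypotheses (bN : blin N) (cW : closed_subspace W) (NW : forall x, W x -> W (N x)).

Hypothesis irrW : irreducible_on N W.

(** A self-adjoint [A] of this kind commutes on [W] also with the adjoint of the
    restriction of [N], so that its kernel in [W] is reducing. *)
Definition commutant (A : H -> H) :=
  [/\ blin A, forall x, W x -> W (A x) & forall x, W x -> A (N x) = N (A x)].

(** The kernel of [A] in [W] and its complement in [W] are orthogonal invariant
    subspaces, hence one of them vanishes: the self-adjoint part of the commutant
    has no zero divisors. *)
Lemma commutant_zero_or_injective A : commutant A -> selfadj A ->
  (forall x, W x -> A x = 0) \/ (forall x, W x -> A x = 0 -> x = 0).
Proof.
move=> [bA AW AN] sA.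
pose U1 := W `&` [set x | A x = 0]; pose U2 := W `&` orthocomp U1.
have cU1 : closed_subspace U1.
  by apply: closed_subspaceI => //; exact: closed_subspace_ker.
have cU2 : closed_subspace U2.
  by apply: closed_subspaceI => //; exact: closed_subspace_orthocomp.
have NU1 x : U1 x -> U1 (N x).
  by move=> [Wx Ax]; split; [exact: NW|rewrite /= AN // Ax (lin0 bN.1)].
have NU2 x : U2 x -> U2 (N x).
  move=> [Wx ox]; split; first exact: NW.
  move=> y [Wy Ay]; rewrite adjP // -(inner_projr _ cW) //; apply: ox.
  have Wp := proj_in (adj N y) cW; split=> //=.
  apply/eqP; rewrite -inner_eq0 sA inner_projl //; last exact/AW/AW.
  by rewrite -adjPr // -AN; [rewrite -sA Ay inner0l|exact: AW].
have U12 x y : U1 x -> U2 y -> inner x y = 0.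
  by move=> U1x [_ oy]; apply: inner_sym0; exact: oy.
have [U10|U20] := irrW cU1 cU2 (@subIsetl _ _ _) (@subIsetl _ _ _) NU1 NU2 U12.
- by right=> x Wx Ax; apply: U10.
- left=> x Wx; suff : U1 x by case.
  suff -> : x = proj U1 x by exact: proj_in.
  apply/eqP; rewrite -subr_eq0; apply/eqP; apply: U20; split.
    by apply: subspaceB => //; have [] := proj_in x cU1.
  by case: (projP x cU1).
Qed.

(** As (A + |A|) (A - |A|) = 0 and there are no zero divisors, [A] is |A| or -|A|
    on [W]. If its form vanishes at x then |A| x = 0, hence A x = 0, and a
    non-injective element of the commutant is zero. *)
Lemma commutant_form_eq0 A x : commutant A -> selfadj A ->
  (forall y, `|A y| <= `|y|) -> W x -> x != 0 -> inner (A x) x = 0 ->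
  forall y, W y -> A y = 0.
Proof.
move=> cA sA contrA Wx x0 Ax0; have [bA AW AN] := cA.
have bY := blin_abs_compl bA sA contrA; have sY := abs_compl_selfadj bA sA contrA.
have bB : blin (absop A) by apply: blinB => //; exact: blin_id.
have sB : selfadj (absop A) by move=> y z; rewrite innerBl innerBr sY.
have BW y : W y -> W (absop A y).
  move=> Wy; apply: subspaceB => //.
  by have [] := abs_compl_commute bA sA contrA bN cW AW AN Wy.
have BN y : W y -> absop A (N y) = N (absop A y).
  move=> Wy; rewrite (linB bN.1); congr (_ - _).
  by have [] := abs_compl_commute bA sA contrA bN cW AW AN Wy.
have AB y : absop A (A y) = A (absop A y).
  by rewrite /absop (linB bA.1) abs_compl_comm_A.
suff Bx : absop A x = 0.
  have [//|Ainj] := commutant_zero_or_injective cA sA.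
  case/eqP: x0; apply: Ainj => //; apply/eqP; rewrite -inner_eq0 sA.
  by rewrite -absop_sqr // Bx (lin0 bB.1) inner0r.
apply: absop_form_eq0 => //.
pose F y := A y + absop A y; pose G y := A y - absop A y.
have cF : commutant F.
  split; first exact: blinD.
    by move=> y Wy; apply: subspaceD; [|exact: AW|exact: BW].
  by move=> y Wy; rewrite /F AN // BN // [RHS](linD bN.1).
have sF : selfadj F by move=> y z; rewrite innerDl innerDr sA sB.
have FG y : F (G y) = 0.
  rewrite /F /G (linB bA.1) (linB bB.1) absop_sqr // AB.
  by rewrite addrA subrK subrr.
have [F0|Finj] := commutant_zero_or_injective cF sF.
  have := F0 x Wx; rewrite /F addrC => /eqP; rewrite addr_eq0 => /eqP ->.
  by rewrite innerNl Ax0 oppr0.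
have : G x = 0.
  by apply: Finj => //; apply: subspaceB; [|exact: AW|exact: BW].
by move/eqP; rewrite /G subr_eq0 => /eqP <-.
Qed.

(** Subtracting a suitable scalar makes the form of [A] vanish at a given vector. *)
Lemma commutant_selfadj_scalar A : commutant A -> selfadj A ->
  exists a : C, forall x, W x -> A x = a *: x.
Proof.
move=> [bA AW AN] sA.
have [W0|/existsNP[x /not_implyP[Wx /eqP x0]]] := pselect (forall x, W x -> x = 0).
  by exists 0 => x /W0 ->; rewrite (lin0 bA.1) scaler0.
pose a := inner (A x) x / inner x x; exists a => y Wy.
have xx0 : inner x x != 0 by rewrite inner_eq0.
have aR : Num.conj a = a.
  by rewrite /a rmorphM fmorphV /= -!innerC sA.
pose D z := A z - a *: z.
have bD : blin D by apply: blinB => //; apply: (blinZ (T := idfun)); exact: blin_id.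
have [c c0 Dc] := bounded_op_gt0 bD.2.
have c0' : 0 < c%:C by rewrite ltcR.
pose E z := c%:C^-1 *: D z.
have cR : Num.conj c%:C^-1 = c%:C^-1.
  by apply/CrealP; rewrite realV gtr0_real.
have cE : commutant E.
  split; first exact: blinZ.
    move=> z Wz; apply: subspaceZ => //; apply: subspaceB => //; first exact: AW.
    exact: subspaceZ.
  by move=> z Wz; rewrite /E /D AN // (linZ bN.1) (linB bN.1) (linZ bN.1).
have sE : selfadj E.
  move=> u v; rewrite innerZl innerZr cR; congr (_ * _).
  by rewrite innerBl innerBr innerZl innerZr aR sA.
have : E y = 0.
  apply: (commutant_form_eq0 cE sE _ Wx x0 _ Wy) => [z|].
    rewrite normrZ gtr0_norm ?invr_gt0 // ler_pdivrMl //; exact: Dc.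
  by rewrite innerZl innerBl innerZl divfK // subrr mulr0.
move/eqP; rewrite scaler_eq0 invr_eq0 (gt_eqF c0') /= subr_eq0.
by move/eqP.
Qed.

(** [A] is a combination of the self-adjoint elements A + A' and i (A - A'), with
    A' its adjoint. *)
Theorem commutant_scalar A : commutant A -> commutant (adj A) ->
  exists a : C, forall x, W x -> A x = a *: x.
Proof.
move=> [bA AW AN] [bA' A'W A'N].
pose B x := A x + adj A x; pose D x := 'i%R *: (A x - adj A x).
have cB : commutant B.
  split; first exact: blinD.
    by move=> x Wx; apply: subspaceD => //; [exact: AW|exact: A'W].
  by move=> x Wx; rewrite /B AN // A'N // (linD bN.1).
have cD : commutant D.
  split; first by apply: blinZ; exact: blinB.
    move=> x Wx; apply: subspaceZ => //.
    by apply: subspaceB => //; [exact: AW|exact: A'W].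
  by move=> x Wx; rewrite /D AN // A'N // (linZ bN.1) (linB bN.1).
have sB : selfadj B.
  by move=> x y; rewrite innerDl innerDr adjP // -adjPr // addrC.
have sD : selfadj D.
  move=> x y; rewrite innerZl innerZr innerBl innerBr adjP // -adjPr // conjCi.
  by rewrite mulNr -mulrN opprB.
have [b Bb] := commutant_selfadj_scalar cB sB.
have [d Dd] := commutant_selfadj_scalar cD sD.
exists (2^-1 * (b - 'i%R * d)) => x Wx.
have : 2 *: A x = B x - 'i%R *: D x.
  rewrite /B /D scalerA mulCii scaleN1r opprK addrACA subrr addr0.
  by rewrite scaler_nat mulr2n.
rewrite Bb // Dd // scalerA -scalerBl => /(congr1 (fun v => 2^-1 *: v)).
by rewrite !scalerA mulVf ?pnatr_eq0 // scale1r.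
Qed.

End Schur.

(** * Tensor products of families of closed subspaces *)

Section Update.
Context {I : eqType} {T : I -> Type}.
Implicit Types (x : forall i, T i).

Lemma upd_id x i : upd x (x i) = x.
Proof.
by apply: boolp.functional_extensionality_dep => j; case: eqtype.dfwithP.
Qed.

Lemma upd_upd x i (u v : T i) : upd (upd x u) v = upd x v.
Proof.
apply: boolp.functional_extensionality_dep => j.
by have [<-|ij] := eqVneq i j; rewrite ?dfwith_in // !dfwith_out.
Qed.

Lemma upd_comm x i j (u : T i) (v : T j) : i != j ->
  upd (upd x u) v = upd (upd x v) u.
Proof.
move=> ij; apply: boolp.functional_extensionality_dep => k.
have [jk|jk] := eqVneq j k.
  by case: k / jk; rewrite dfwith_in dfwith_out // dfwith_in.
rewrite dfwith_out //.
have [ik|ik] := eqVneq i k; first by case: k / ik jk => _; rewrite !dfwith_in.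
by rewrite !dfwith_out.
Qed.

Lemma upd_prop (P : forall i, T i -> Prop) x i (u : T i) :
  P i u -> (forall j, j != i -> P j (x j)) -> forall j, P j (upd x u j).
Proof.
move=> Pu Px j; have [ij|ij] := eqVneq i j; last first.
  by rewrite dfwith_out //; apply: Px; rewrite eq_sym.
by case: j / ij; rewrite dfwith_in.
Qed.

End Update.

Section TensorProduct.
Context {R : realType} {n : nat} {H : 'I_n -> hilbertType R} {K : hilbertType R}.
Variable tens : (forall i, H i) -> K.
Hypothesis tensP : @hilbert_tensor R n H K tens.
Local Notation C := R[i].
Local Notation vecs := (forall i, H i).
Local Notation T := (tensor_subspace tens).
Implicit Types (x y z : vecs) (W : forall i, set (H i)) (S : set K).

Definition slice x i (u : H i) : K := tens (upd x u).

Lemma inner_tens x y : inner (tens x) (tens y) = \prod_(i < n) inner (x i) (y i).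
Proof. exact: tens_inner. Qed.

Lemma inner_slice x y i (u v : H i) : inner (slice x u) (slice y v) =
  inner u v * \prod_(j < n | j != i) inner (x j) (y j).
Proof.
rewrite inner_tens (bigD1 i) //= !dfwith_in; congr (_ * _).
by apply: eq_bigr => j ji; rewrite !dfwith_out // eq_sym.
Qed.

Lemma slice_id x i : slice x (x i) = tens x.
Proof. by rewrite /slice upd_id. Qed.

Lemma blin_slice x i : blin (@slice x i).
Proof.
split; first exact: tens_linear.
exists (\prod_(j < n | j != i) complex.Re `|x j|) => u.
rewrite -(ler_pXn2r (n := 2)) ?nnegrE ?mulr_ge0 //; last first.
  by rewrite ler0c prodr_ge0 // => j _; rewrite -ler0c normr_Re.
rewrite -innerE inner_slice exprMn innerE mulrC ler_wpM2r ?exprn_ge0 //.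
rewrite rmorph_prod -prodrXl /=.
rewrite [leRHS](eq_bigr (fun j => inner (x j) (x j))) // => j _.
by rewrite innerE normr_Re.
Qed.

Lemma tens_eq0 x i : x i = 0 -> tens x = 0.
Proof. by move=> xi; rewrite -(slice_id x i) xi (lin0 (blin_slice _ _).1). Qed.

Lemma closed_subspace_T W : closed_subspace (T W).
Proof. exact: closed_subspace_span. Qed.
Hint Resolve closed_subspace_T : core.

Lemma T_tens W x : (forall i, W i (x i)) -> T W (tens x).
Proof. by move=> Wx; apply: closed_span_sub; exists x. Qed.

Lemma T_min W S : closed_subspace S ->
  (forall x, (forall i, W i (x i)) -> S (tens x)) -> T W `<=` S.
Proof. by move=> cS WS; apply: closed_span_min => // _ [x Wx <-]; exact: WS. Qed.

Lemma T_setT : T (fun=> setT) = setT.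
Proof.
rewrite -(tens_total tensP); congr closed_span.
by apply/seteqP; split=> _ [x _ <-]; exists x.
Qed.

Lemma T_sub W W' : (forall i, W i `<=` W' i) -> T W `<=` T W'.
Proof.
by move=> WW'; apply: T_min => // x Wx; apply: T_tens => i; exact/WW'/Wx.
Qed.

Lemma blin_eq_on (V : hilbertType R) (f g : K -> V) W : blin f -> blin g ->
  (forall x, (forall i, W i (x i)) -> f (tens x) = g (tens x)) ->
  forall k, T W k -> f k = g k.
Proof.
move=> bf bg fg k Wk; apply/eqP; rewrite -subr_eq0; apply/eqP; move: k Wk.
apply: T_min; first exact: (closed_subspace_ker (blinB bf bg)).
by move=> x Wx /=; rewrite fg // subrr.
Qed.

Lemma blin_eq (V : hilbertType R) (f g : K -> V) : blin f -> blin g ->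
  (forall x, f (tens x) = g (tens x)) -> f = g.
Proof.
move=> bf bg fg; apply/funext => k; apply: (blin_eq_on (W := fun=> setT)) => //.
by rewrite T_setT.
Qed.

Lemma tens_ext (k l : K) :
  (forall x, inner k (tens x) = inner l (tens x)) -> k = l.
Proof.
move=> kl; apply/eqP; rewrite -subr_eq0 -inner_eq0; apply/eqP.
suff : T (fun=> setT) `<=` orthocomp [set k - l].
  by rewrite T_setT => /(_ (k - l) I); apply.
apply: T_min; first exact: closed_subspace_orthocomp.
by move=> x _ _ ->; apply: inner_sym0; rewrite innerBl kl subrr.
Qed.

Lemma tens_scale (c : 'I_n -> C) x :
  tens (fun i => c i *: x i) = (\prod_i c i) *: tens x.
Proof.
apply: tens_ext => y; rewrite innerZl !inner_tens -big_split /=.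
by apply: eq_bigr => i _; rewrite innerZl.
Qed.

(** ** Projections onto tensor products of subspaces *)

Lemma proj_T W x : (forall i, closed_subspace (W i)) ->
  proj (T W) (tens x) = tens (fun i => proj (W i) (x i)).
Proof.
move=> cW; apply: proj_unique => //.
  by apply: T_tens => i; exact: proj_in.
set d := _ - _; suff dW : T W `<=` orthocomp [set d].
  by move=> y /dW /(_ d erefl) /inner_sym0.
apply: T_min; first exact: closed_subspace_orthocomp.
move=> y Wy _ ->; apply: inner_sym0; rewrite innerBl !inner_tens.
apply/eqP; rewrite subr_eq0; apply/eqP/eq_bigr => i _.
by rewrite inner_projl.
Qed.

(** H_1 (x) ... (x) W0 (x) ... (x) H_n, with [W0] in position i. The projection onto
    it is the ampliation of the projection onto [W0], which gives access to
    operators on a single factor. *)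
Definition slab i (W0 : set (H i)) : set K :=
  T (upd (fun j => [set: H j]) W0).

Definition acts_at i (B : H i -> H i) (A : K -> K) :=
  forall x, A (tens x) = slice x (B (x i)).

Lemma closed_slab i (W0 : set (H i)) : closed_subspace (slab W0).
Proof. exact: closed_subspace_T. Qed.
Hint Resolve closed_slab : core.

Lemma proj_slab i (W0 : set (H i)) : closed_subspace W0 ->
  acts_at (proj W0) (proj (slab W0)).
Proof.
move=> cW0 x; rewrite proj_T; last first.
  exact: (upd_prop (P := fun j => @closed_subspace R (H j))).
congr tens; apply: boolp.functional_extensionality_dep => j.
have [ij|ij] := eqVneq i j; first by case: j / ij; rewrite !dfwith_in.
rewrite !dfwith_out // proj_id //; exact: closed_subspaceT.
Qed.

Lemma slab_tens i (W0 : set (H i)) x : W0 (x i) -> slab W0 (tens x).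
Proof.
move=> Wx; apply: T_tens.
exact: (@upd_prop _ _ (fun j A => A (x j)) (fun=> setT) i W0 Wx
  (fun _ _ => I)).
Qed.

Lemma slab_setT i : slab [set: H i] = setT.
Proof. by rewrite /slab (upd_id (fun j => [set: H j])) T_setT. Qed.

Lemma adj_acts_at i B A : blin B -> blin A -> @acts_at i B A ->
  acts_at (adj B) (adj A).
Proof.
move=> bB bA BA x; apply: tens_ext => y.
by rewrite -adjPr // BA -(slice_id x i) -(slice_id y i) !inner_slice adjPr.
Qed.

Lemma acts_at_comm i j B A B' A' : i != j -> blin A -> blin A' ->
  @acts_at i B A -> @acts_at j B' A' -> forall k, A (A' k) = A' (A k).
Proof.
move=> ij bA bA' BA BA' k; suff /(congr1 (@^~ k)) : A \o A' = A' \o A by [].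
apply: blin_eq; [exact: blin_comp..|] => x /=.
rewrite BA' BA /slice BA BA' /slice !dfwith_out //; last by rewrite eq_sym.
by rewrite upd_comm // eq_sym.
Qed.

(** The projection onto a product of subspaces is the composite of the projections
    onto the slabs of its factors. [D] selects the factors to be projected. *)
Lemma proj_T_invariant (D : pred 'I_n) W S :
  (forall i, closed_subspace (W i)) ->
  (forall i, D i -> forall s, S s -> S (proj (slab (W i)) s)) ->
  forall s, S s -> S (proj (T (fun i => if D i then W i else setT)) s).
Proof.
move=> cW DS s Ss.
pose F m : forall i, set (H i) :=
  fun i => if D i && (i < m)%N then W i else setT.
have cF m i : closed_subspace (F m i).
  by rewrite /F; case: ifP => // _; exact: closed_subspaceT.
(* [F m] projects the selected factors of index below [m]. *)
have key m : (m <= n)%N -> S (proj (T (F m)) s).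
  elim: m => [|m IH] mn.
    have -> : F 0%N = fun=> setT.
      by apply: boolp.functional_extensionality_dep => i; rewrite /F ltn0 andbF.
    by rewrite T_setT proj_id //; exact: closed_subspaceT.
  have Fm i : i != Ordinal mn -> F m.+1 i = F m i.
    by move=> im; rewrite /F ltnS leq_eqVlt -val_eqE /= in im *; rewrite (negPf im).
  have [Dm|Dm] := boolP (D (Ordinal mn)).
    have -> : proj (T (F m.+1)) s = proj (slab (W (Ordinal mn))) (proj (T (F m)) s).
      suff /(congr1 (@^~ s)) :
        proj (T (F m.+1)) = proj (slab (W (Ordinal mn))) \o proj (T (F m)) by [].
      apply: blin_eq; [exact: blin_proj|by apply: blin_comp; exact: blin_proj|].
      move=> x /=; rewrite [LHS]proj_T // [proj (T (F m)) _]proj_T // proj_slab //.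
      congr tens.
      apply: boolp.functional_extensionality_dep => i.
      have [<-|im] := eqVneq (Ordinal mn) i; last first.
        by rewrite dfwith_out // Fm // eq_sym.
      by rewrite dfwith_in /F /= Dm ltnS leqnn ltnn /= [proj setT _]proj_id.
    by apply: DS => //; exact/IH/ltnW.
  have -> : F m.+1 = F m; last exact/IH/ltnW.
  apply: boolp.functional_extensionality_dep => i.
  have [->|/Fm //] := eqVneq i (Ordinal mn).
  by rewrite /F (negPf Dm).
have -> : (fun i => if D i then W i else setT) = F n; last exact: key.
by apply: boolp.functional_extensionality_dep => i; rewrite /F ltn_ord andbT.
Qed.

Lemma sub_T W S : (forall i, closed_subspace (W i)) ->
  (forall i, S `<=` slab (W i)) -> S `<=` T W.
Proof.
move=> cW SW s Ss.
have /= sE : proj (T (fun i => if predT i then W i else setT)) s = s.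
  apply: (@proj_T_invariant predT W [set s]) => // i _ _ ->.
  by rewrite /= proj_id //; exact: SW.
by rewrite -sE; exact: proj_in.
Qed.

(** ** The support of a subspace in one factor *)

(** The smallest closed [W0] with [S] contained in [slab W0], described by its
    orthogonal complement. *)
Definition support i S : set (H i) :=
  orthocomp [set u | forall x s, S s -> inner (slice x u) s = 0].

Lemma closed_support i S : closed_subspace (@support i S).
Proof. exact: closed_subspace_orthocomp. Qed.
Hint Resolve closed_support : core.

Lemma orthocomp_support i S : orthocomp (@support i S) =
  [set u | forall x s, S s -> inner (slice x u) s = 0].
Proof.
rewrite /support orthocompK //.
have -> : [set u | forall x s, S s -> inner (@slice x i u) s = 0] =
  \bigcap_(p in [set p : vecs * K | S p.2])
     [set u | inner (slice p.1 u) p.2 = 0].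
  apply/seteqP; split=> u h; first by case=> x s; exact: h.
  by move=> x s; exact: (h (x, s)).
apply: closed_subspace_bigI => -[x s] _ /=.
apply: (@closed_subspace_ker _ _ _ (fun u => inner (slice x u) s : C^o)).
exact: (blin_comp (blin_innerl s) (@blin_slice x i)).
Qed.

(** Changing x_i by a vector orthogonal to the support does not change the inner
    products of [tens x] with the elements of [S]. *)
Lemma sub_slab_support i S : S `<=` slab (@support i S).
Proof.
move=> s Ss; suff -> : s = proj (slab (@support i S)) s by exact: proj_in.
apply: tens_ext => x; rewrite proj_selfadj // proj_slab // -{1}(slice_id x i).
apply/eqP; rewrite -subr_eq0 -innerBr -(linB (blin_slice _ _).1); apply/eqP.
apply: inner_sym0.
have : orthocomp (@support i S) (x i - proj (@support i S) (x i)).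
  by case: (projP (x i) (@closed_support i S)).
by rewrite orthocomp_support; apply.
Qed.

(** ** Subspaces split off one factor at a time *)

(** As a closed span, hence closed by construction. *)
Definition line (i : 'I_n) (w : H i) : set (H i) := closed_span [set w].

Lemma closed_line i (w : H i) : closed_subspace (line w).
Proof. exact: closed_subspace_span. Qed.
Hint Resolve closed_line : core.

Lemma line_in i (w : H i) : line w w.
Proof. exact: closed_span_sub. Qed.

Lemma proj_line i (w u : H i) : proj (line w) u = (inner u w / inner w w) *: w.
Proof.
have [->|w0] := eqVneq w 0.
  rewrite scaler0; apply: proj_eq0 => //.
  suff l0 : line 0 `<=` orthocomp [set u].
    by move=> y /l0 /(_ u erefl) /inner_sym0.
  apply: closed_span_min; first exact: closed_subspace_orthocomp.
  by move=> _ -> y _; rewrite inner0l.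
have lw := @line_in i w; have cl := @closed_line i w.
apply: (proj_unique cl); first exact: (subspaceZ _ cl lw).
set d := _ - _; suff ld : line w `<=` orthocomp [set d].
  by move=> y /ld /(_ d erefl) /inner_sym0.
apply: closed_span_min; first exact: closed_subspace_orthocomp.
move=> _ -> _ ->; apply: inner_sym0.
by rewrite innerBl innerZl divfK ?subrr // inner_eq0.
Qed.

(** The projections onto the lines of [W0] generate all operators on [W0]: a regular
    [S] contained in [slab W0] is of the form W0 (x) S'. *)
Definition regular S i (W0 : set (H i)) :=
  forall w, W0 w -> forall s, S s -> S (proj (slab (line w)) s).

(** Projecting [tens x] onto the slab of the line through w replaces x_i by a
    multiple of w, which is non-zero unless x_i and w are orthogonal; in that case
    x_i + w serves instead of w. *)
Lemma regular_exchange S i (W0 : set (H i)) x w : closed_subspace S ->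
  closed_subspace W0 -> regular S W0 -> W0 (x i) -> x i != 0 -> W0 w ->
  S (tens x) -> S (slice x w).
Proof.
move=> cS cW0 rS Wx x0 Ww Sx.
have key v : W0 v -> inner (x i) v != 0 -> S (slice x v).
  move=> Wv xv0; have v0 : inner v v != 0.
    by rewrite inner_eq0; apply: contra_neq xv0 => ->; rewrite inner0r.
  have := rS v Wv _ Sx; rewrite proj_slab // proj_line (linZ (blin_slice _ _).1).
  move/(subspaceZ (inner (x i) v / inner v v)^-1 cS).
  by rewrite scalerA mulVf ?scale1r // mulf_neq0 ?invr_eq0.
have [xw|xw] := eqVneq (inner (x i) w) 0; last exact: key.
have : S (slice x (x i + w)).
  by apply: key; [exact: subspaceD|rewrite innerDr xw addr0 inner_eq0].
rewrite (linD (blin_slice _ _).1) slice_id => Sxw.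
by rewrite -[slice x w](addKr (tens x)) addrC; exact: subspaceB.
Qed.

Lemma regular_exchange_all (D : pred 'I_n) S W x y : closed_subspace S ->
  (forall i, closed_subspace (W i)) -> (forall i, D i -> regular S (W i)) ->
  (forall i, D i -> W i (x i) /\ x i != 0) -> (forall i, D i -> W i (y i)) ->
  S (tens x) -> S (tens (fun i => if D i then y i else x i)).
Proof.
move=> cS cW rS Wx Wy Sx.
pose F m : vecs := fun i => if D i && (i < m)%N then y i else x i.
have key m : (m <= n)%N -> S (tens (F m)).
  elim: m => [|m IH] mn.
    have -> // : F 0%N = x.
    by apply: boolp.functional_extensionality_dep => i; rewrite /F ltn0 andbF.
  have Fm i : i != Ordinal mn -> F m.+1 i = F m i.
    by move=> im; rewrite /F ltnS leq_eqVlt -val_eqE /= in im *; rewrite (negPf im).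
  have Fmm : F m (Ordinal mn) = x (Ordinal mn) by rewrite /F ltnn andbF.
  have [Dm|Dm] := boolP (D (Ordinal mn)).
    have -> : F m.+1 = upd (F m) (y (Ordinal mn)).
      apply: boolp.functional_extensionality_dep => i.
      have [<-|im] := eqVneq (Ordinal mn) i.
        by rewrite dfwith_in /F Dm /= ltnSn.
      by rewrite dfwith_out // Fm // eq_sym.
    apply: (regular_exchange cS (cW _) (rS _ Dm)); rewrite ?Fmm.
    - by have [] := Wx _ Dm.
    - by have [] := Wx _ Dm.
    - exact: Wy.
    - exact/IH/ltnW.
  have -> : F m.+1 = F m; last exact/IH/ltnW.
  apply: boolp.functional_extensionality_dep => i.
  have [->|/Fm //] := eqVneq i (Ordinal mn).
  by rewrite /F (negPf Dm).
have -> : (fun i => if D i then y i else x i) = F n; last exact: key.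
by apply: boolp.functional_extensionality_dep => i; rewrite /F ltn_ord andbT.
Qed.

End TensorProduct.

Section TensorFactors.
Context {R : realType} {n : nat} {H : 'I_n -> hilbertType R} {K : hilbertType R}.
Variable tens : (forall i, H i) -> K.
Hypothesis tensP : @hilbert_tensor R n H K tens.
Local Notation C := R[i].
Local Notation vecs := (forall i, H i).
Local Notation T := (tensor_subspace tens).
Local Notation slice := (slice tens).
Local Notation slab := (slab tens).
Local Notation regular := (regular tens).
Implicit Types (x y z : vecs) (W : forall i, set (H i)) (S : set K).

Lemma adj_slice_tens y i z : adj (@slice y i) (tens z) =
  (\prod_(j < n | j != i) inner (z j) (y j)) *: z i.
Proof.
apply: inner_extr => u; rewrite -adjP; last exact: blin_slice.
rewrite -(slice_id tens z i) inner_slice // innerZr mulrC; congr (_ * _).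
by rewrite rmorph_prod; apply: eq_bigr => j _; exact: innerC.
Qed.

(** The left-hand side is a [slice] in the [i]-th factor, and the right-hand side
    is built from projections onto slabs of lines, under which regular subspaces
    are invariant. *)
Lemma slice_adj_slice y i k :
  slice y (adj (@slice y i) k) =
  (\prod_(j < n | j != i) inner (y j) (y j)) *:
    proj (T (fun j => if j != i then line (y j) else setT)) k.
Proof.
have bs := @blin_slice _ _ _ _ _ tensP y i.
have cF j : closed_subspace (if j != i then line (y j) else setT).
  by case: ifP => _; [exact: closed_line|exact: closed_subspaceT].
set c := \prod_(_ < _ | _) _; set L := T _.
have cL : closed_subspace L by exact: closed_subspace_T.
have [[j ji yj]|y0] := pselect (exists2 j, j != i & y j = 0).
  have -> : c = 0 by rewrite /c (bigD1 j) //= yj inner0l mul0r.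
  rewrite scale0r; apply: (tens_eq0 tensP (i := j)).
  by rewrite dfwith_out // eq_sym.
suff /(congr1 (@^~ k)) : @slice y i \o adj (@slice y i) = (fun l => c *: proj L l).
  by [].
apply: (blin_eq tensP).
- exact: blin_comp bs (blin_adj bs).
- by apply: blinZ; exact: blin_proj.
move=> z /=; rewrite adj_slice_tens (linZ bs.1) (proj_T tensP) //.
pose c' j := if j != i then inner (z j) (y j) / inner (y j) (y j) else 1.
have -> : (fun j => proj (if j != i then line (y j) else setT) (z j)) =
          (fun j => c' j *: upd y (z i) j).
  apply: boolp.functional_extensionality_dep => j; rewrite /c'.
  have [->|ji] /= := eqVneq j i.
    by rewrite dfwith_in scale1r proj_id //; exact: closed_subspaceT.
  by rewrite proj_line dfwith_out // eq_sym.
rewrite (tens_scale tensP) scalerA; congr (_ *: _).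
rewrite [\prod_j c' j](bigD1 i) //= {1}/c' eqxx mul1r /c -big_split /=.
apply: eq_bigr => j ji.
rewrite /c' ji mulrC divfK // inner_eq0; apply/eqP => yj.
by apply: y0; exists j.
Qed.

(** The vectors u for which [slice x u] lies in [S] form the same subspace U of H_i
    for all x, by exchanging the other coordinates one at a time. Contracting
    elements of [S] against the other factors yields vectors of U, and every
    vector orthogonal to all these contractions is orthogonal to the support. *)
Theorem tensor_of_regular S (i : 'I_n) W : closed_subspace S ->
  (forall j, closed_subspace (W j)) -> (forall j, S `<=` slab (W j)) ->
  (forall j, j != i -> regular S (W j)) -> W i `<=` support tens (i := i) S ->
  S = T W.
Proof.
move=> cS cW SW rS WS; apply/seteqP; split; first exact: sub_T.
apply: T_min => // x Wx; rewrite -(slice_id tens x i).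
have cU : closed_subspace [set u | S (@slice x i u)].
  exact: (closed_subspace_preim (@blin_slice _ _ _ _ _ tensP x i) cS).
suff : W i `<=` [set u | S (@slice x i u)] by apply; exact: Wx.
rewrite -(orthocompK cU) => u Wu w oUw; apply: inner_sym0.
suff : orthocomp (support tens (i := i) S) w by apply; exact: WS.
rewrite orthocomp_support // => y s Ss.
have cF j : closed_subspace (if j != i then W j else setT).
  by case: ifP => // _; exact: closed_subspaceT.
(* As [S] lies in the slabs, [y] only matters through its projections. *)
pose y' j := proj (W j) (y j).
have -> : inner (slice y w) s = inner (slice y' w) s.
  have := @proj_T_invariant _ _ _ _ _ tensP (fun j => j != i) W [set s] cW.
  move=> /(_ _ s erefl) sE; rewrite -[in LHS]sE; last first.
    by move=> j _ _ ->; rewrite /= proj_id //; [exact: closed_slab|exact: SW].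
  rewrite -proj_selfadj; last exact: closed_subspace_T.
  rewrite proj_T //; congr (inner (tens _) s).
  apply: boolp.functional_extensionality_dep => j.
  have [<-|ij] := eqVneq i j; last by rewrite !dfwith_out // eq_sym ij.
  by rewrite !dfwith_in /= proj_id //; exact: closed_subspaceT.
have Wy' j : W j (y' j) by exact: proj_in.
have [[j ji yj]|y0] := pselect (exists2 j, j != i & y' j = 0).
  by rewrite /slice (tens_eq0 tensP (i := j)) ?inner0l // dfwith_out // eq_sym.
have bs := @blin_slice _ _ _ _ _ tensP y' i.
rewrite adjP //; apply: oUw; set v := adj _ s.
have Sv : S (slice y' v).
  rewrite slice_adj_slice; apply: subspaceZ => //.
  apply: (@proj_T_invariant _ _ _ _ _ tensP (fun j => j != i)
           (fun j => line (y' j))) => //.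
    by move=> j; exact: closed_line.
  by move=> j ji t St; apply: rS.
have -> : [set u | S (slice x u)] v = S (tens (fun j =>
    if j != i then x j else upd y' v j)).
  congr (S (tens _)); apply: boolp.functional_extensionality_dep => j.
  have [->|ji] := eqVneq j i; first by rewrite !dfwith_in.
  by rewrite dfwith_out // eq_sym.
apply: (regular_exchange_all tensP cS cW rS) => // j ji.
rewrite dfwith_out 1?eq_sym //; split=> //; apply/eqP => yj.
by apply: y0; exists j.
Qed.

(** ** Splitting off a factor by the Schur lemma *)

(** The projection P onto [S] commutes with the compression of [A] to the slab and
    with its adjoint. Fixing elementary tensors x and y in the other factors, the
    operator u |-> <P (x (x) u), y (x) .> on H_i therefore satisfies the hypotheses
    of the Schur lemma and is scalar on [W0]. A projection whose coefficients are
    all scalar commutes with the projections onto the slabs of lines. *)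
Theorem regular_of_reducing i (B : H i -> H i) (A : K -> K) (W0 : set (H i)) S :
  blin B -> blin A -> acts_at tens B A -> closed_subspace W0 ->
  (forall u, W0 u -> W0 (adj B u)) ->
  irreducible_on (adj B) W0 ->
  closed_subspace S -> S `<=` slab W0 ->
  (forall s, S s -> S (adj A s)) ->
  (forall s, S s -> S (proj (slab W0) (A s))) ->
  regular S W0.
Proof.
move=> bB bA BA cW0 BW irrW cS SW AS PAS.
have bN := blin_adj bB; have bP := blin_proj cS.
have cl : closed_subspace (slab W0) by exact: closed_slab.
have bs x : blin (@slice x i) by exact: blin_slice.
pose coef x y := adj (@slice y i) \o (proj S \o @slice x i).
have bcoef x y : blin (coef x y).
  by apply: blin_comp; [exact: blin_adj|exact: blin_comp].
have coefE x y u v : inner (coef x y u) v = inner (proj S (slice x u)) (slice y v).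
  by rewrite -adjPr.
have adj_coef x y : adj (coef x y) = coef y x.
  apply: adj_unique => // u v; rewrite coefE proj_selfadj //.
  by rewrite innerC -coefE -innerC.
have PA k : slab W0 k -> proj S (adj A k) = adj A (proj S k).
  move=> Wk; apply: proj_unique => //; first by apply: AS; exact: proj_in.
  move=> s Ss; rewrite -(linB (blin_adj bA).1) -adjPr // -(inner_projr _ cl).
    by apply: proj_orth => //; exact: PAS.
  by apply: (subspaceB cl) => //; apply: SW; exact: proj_in.
have comm x y : commutant (adj B) W0 (coef x y).
  split=> // u Wu.
    rewrite -(orthocompK cW0) => w ow; rewrite coefE.
    have /SW Wp := proj_in (slice x u) cS.
    rewrite -(proj_id cl Wp) proj_selfadj // (proj_slab tensP cW0) dfwith_in.
    by rewrite (proj_eq0 cW0 ow) (lin0 (bs _).1) inner0r.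
  have sN : slice x (adj B u) = adj A (slice x u).
    by rewrite (adj_acts_at tensP bB bA BA) dfwith_in /slice upd_upd.
  rewrite /coef /= sN PA; last by apply: slab_tens; rewrite dfwith_in.
  have : adj (A \o @slice y i) = adj (@slice y i \o B).
    by congr adj; apply/funext => v /=; rewrite BA dfwith_in /slice upd_upd.
  rewrite (adj_comp bA (bs y)) (adj_comp (bs y) bB).
  by move=> /(congr1 (@^~ (proj S (slice x u)))).
have scal x y : exists a : C, forall u, W0 u -> coef x y u = a *: u.
  by apply: (commutant_scalar bN cW0 BW irrW) => //; rewrite adj_coef.
move=> w Ww s Ss.
have cE : closed_subspace (slab (line w)) by exact: closed_slab.
have tE x : proj (slab (line w)) (tens x) =
    slice x ((inner (x i) w / inner w w) *: w).
  by rewrite proj_slab ?proj_line //; exact: closed_line.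
have [w0|w0] := eqVneq w 0.
  suff /(congr1 (@^~ s)) -> : proj (slab (line w)) = fun=> 0 by exact: subspace0.
  apply: (blin_eq tensP); first exact: blin_proj.
    split; first by move=> a x y; rewrite scaler0 addr0.
    by exists 0 => x; rewrite normr0 mul0r.
  by move=> x; rewrite tE w0 scaler0 (lin0 (bs _).1).
have ww0 : inner w w != 0 by rewrite inner_eq0.
suff PE : proj S \o proj (slab (line w)) = proj (slab (line w)) \o proj S.
  have /(congr1 (@^~ s)) /= := PE; rewrite (proj_id cS Ss) => <-.
  exact: proj_in.
have bE := blin_proj cE.
apply: (blin_eq tensP); [exact: blin_comp..|] => x; apply: (tens_ext tensP) => y /=.
rewrite [RHS]proj_selfadj // !tE -(slice_id tens y i) -(slice_id tens x i).
rewrite -!coefE (linZ (bcoef _ _).1) innerZl innerZr.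
have [a aP] := scal x y; have [b bP'] := scal y x.
have ab : a = Num.conj b.
  have := adjP w w (bcoef x y); rewrite adj_coef aP // bP' // innerZl innerZr.
  by move/mulIf; apply.
rewrite aP // (adjP _ _ (bcoef x y)) adj_coef bP' // innerZl innerZr -ab.
rewrite rmorphM fmorphV /=.
by rewrite -!innerC; ring.
Qed.

End TensorFactors.

(** * Quotient modules, invariant hulls and reducing subspaces *)

Section Modules.
Context {R : realType} {K : hilbertType R}.
Implicit Types (S Q : set K) (A : K -> K).

Lemma proj_adj_comm S A k : blin A -> closed_subspace S ->
  (forall s, S s -> S (A s)) -> (forall s, S s -> S (adj A s)) ->
  proj S (adj A k) = adj A (proj S k).
Proof.
move=> bA cS AS A'S; apply: proj_unique => //; first by apply: A'S; exact: proj_in.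
move=> s Ss; rewrite -(linB (blin_adj bA).1) -adjPr //.
by apply: proj_orth => //; exact: AS.
Qed.

(** For q in [Q], <P_Q A q, x> = <q, A' x> with A' the adjoint of [A], and A' x
    already lies in [Q]. *)
Lemma adjoint_on_compression Q A x : blin A -> closed_subspace Q ->
  (forall q, Q q -> Q (adj A q)) -> Q x ->
  adjoint_on Q (compression Q A) x = adj A x.
Proof.
move=> bA cQ AQ Qx; apply: adjoint_on_unique => //; first exact: AQ.
by move=> y Qy; rewrite inner_projl // adjP.
Qed.

Context {I : Type}.
Variable M : I -> K -> K.
Hypothesis bM : forall i, blin (M i).
Implicit Types (J : set I).

Lemma quotient_moduleP Q : quotient_module M Q <->
  closed_subspace Q /\ forall i q, Q q -> Q (adj (M i) q).
Proof.
split=> -[cQ]; last first.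
  move=> MQ; split=> //; split; first exact: closed_subspace_orthocomp.
  by move=> i _ [x ox <-]; apply: orthocomp_adj_invariant => //; exact: MQ.
move=> [_ MQ]; split=> // i q Qq; rewrite -(orthocompK cQ).
apply: orthocomp_invariant => //; last by rewrite orthocompK.
by move=> x ox; apply: (MQ i); exists x.
Qed.

Lemma hull_sub J Q : Q `<=` invariant_hull M J Q.
Proof. exact: sub_gen_smallest. Qed.

Lemma hull_min J Q S : closed_subspace S ->
  (forall i, J i -> forall s, S s -> S (M i s)) -> Q `<=` S ->
  invariant_hull M J Q `<=` S.
Proof.
move=> cS MS QS; apply: smallest_sub => //; split=> // i Ji _ [s Ss <-].
exact: MS.
Qed.

Lemma closed_hull J Q : closed_subspace (invariant_hull M J Q).
Proof. by apply: (@closed_subspace_bigI _ _ _ _ id) => S [[]]. Qed.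

Lemma hull_invariant J Q i s : J i ->
  invariant_hull M J Q s -> invariant_hull M J Q (M i s).
Proof.
by move=> Ji hs S [[cS MS] QS]; apply: (MS i Ji); exists s => //; apply: hs.
Qed.

End Modules.

Section Standard.
Context {R : realType} (H : rkHilbertModuleType R).
Local Notation Mz := (mulz : H -> H).

Lemma blin_mulz : blin Mz.
Proof. by split; [exact: linearP|exact: mulz_bounded]. Qed.

Lemma quotient_module1P (Q : set H) : quotient_module1 Q <->
  closed_subspace Q /\ forall q, Q q -> Q (adj Mz q).
Proof.
split=> [/(quotient_moduleP (fun=> blin_mulz))[cQ MQ]|[cQ MQ]].
  by split=> // q; exact: (MQ tt).
by apply/(quotient_moduleP (fun=> blin_mulz)).
Qed.

Hypothesis stdH : standard H.

Lemma standard_irreducible (W : set H) : irreducible_on (adj Mz) W.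
Proof.
move=> U1 U2 cU1 cU2 _ _ NU1 NU2 U12; apply: contrapT => /not_orP[U10 U20].
apply: stdH; exists U1, U2; split=> //.
- by split; [exact/quotient_module1P|move=> U1E; apply: U10; rewrite U1E].
- by split; [exact/quotient_module1P|move=> U2E; apply: U20; rewrite U2E].
Qed.

(** The complement of an invariant subspace containing [Q] is a quotient module
    orthogonal to [Q]. *)
Lemma standard_generates (Q U : set H) : quotient_module1 Q ->
  ~ Q `<=` [set 0] -> closed_subspace U -> (forall u, U u -> U (mulz u)) ->
  Q `<=` U -> U = setT.
Proof.
move=> /quotient_module1P[cQ NQ] Q0 cU MU QU; apply: orthocomp_eq0 => //.
have oQ x y : Q x -> orthocomp U y -> inner x y = 0.
  by move=> /QU Ux oy; apply: inner_sym0; exact: oy.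
have oN x : orthocomp U x -> orthocomp U (adj Mz x).
  by apply: orthocomp_invariant => //; exact: blin_mulz.
by have [] := standard_irreducible (W := setT) cQ (closed_subspace_orthocomp U)
  (fun _ _ => I) (fun _ _ => I) NQ oN oQ.
Qed.

End Standard.

(** * The tensor product of standard modules *)

Section ModuleTensor.
Context {R : realType} {n : nat} {H : 'I_n -> rkHilbertModuleType R}.
Context {K : hilbertType R}.
Variables (tens : (forall i, H i) -> K) (M : 'I_n -> {linear K -> K}).
Hypothesis KM : hilbert_module_tensor tens M.
Local Notation C := R[i].
Local Notation T := (@tensor_subspace R n H K tens).
Local Notation slice := (@slice R n H K tens).
Local Notation slab := (@slab R n H K tens).
Local Notation regular := (@regular R n H K tens).
Local Notation support := (@support R n H K tens).
Local Notation acts_at := (@acts_at R n H K tens).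
Local Notation Mz i := (mulz : H i -> H i).
Implicit Types (x y z : forall i, H i) (W : forall i, set (H i)) (S Q : set K).

Let tensP : @hilbert_tensor R n H K tens := module_tensor KM.

Lemma blin_M i : blin (M i : K -> K).
Proof. by split; [exact: linearP|exact: module_bounded KM i]. Qed.

Lemma acts_at_M i : acts_at (Mz i) (M i).
Proof. by move=> x; exact: module_tens KM i x. Qed.

Lemma blin_adjM i : blin (adj (M i : K -> K)).
Proof. exact: blin_adj (blin_M i). Qed.

Lemma acts_at_adjM i : acts_at (adj (Mz i)) (adj (M i : K -> K)).
Proof. exact (adj_acts_at tensP (blin_mulz (H i)) (blin_M i) (@acts_at_M i)). Qed.

Lemma M_slice i x (u : H i) : M i (slice x u) = slice x (Mz i u).
Proof. by rewrite acts_at_M dfwith_in /slice upd_upd. Qed.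

Lemma T_invariant W i (B : H i -> H i) A : blin A -> acts_at B A ->
  (forall u, W i u -> W i (B u)) -> forall s, T W s -> T W (A s).
Proof.
move=> bA BA BW; apply: T_min.
  exact: (closed_subspace_preim bA (closed_subspace_T tens W)).
move=> x Wx /=; rewrite BA; apply: T_tens.
exact: (@upd_prop _ _ (fun j u => W j u) x i _ (BW _ (Wx i)) (fun j _ => Wx j)).
Qed.

(** [A] moves the product only out of its [i]-th factor. *)
Lemma proj_T_acts W i (B : H i -> H i) A s :
  (forall j, closed_subspace (W j)) -> blin A -> acts_at B A -> T W s ->
  proj (T W) (A s) = proj (slab (W i)) (A s).
Proof.
move=> cW bA BA.
apply: (@blin_eq_on _ _ _ _ tens K (proj (T W) \o A) (proj (slab (W i)) \o A) W).
- exact: blin_comp (blin_proj (closed_subspace_T tens W)) bA.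
- exact: blin_comp (blin_proj (closed_slab _ _)) bA.
move=> x Wx /=; rewrite BA proj_T // proj_slab // dfwith_in /slice upd_upd.
congr tens; apply: boolp.functional_extensionality_dep => j.
have [<-|ij] := eqVneq i j; first by rewrite !dfwith_in.
by rewrite !dfwith_out // proj_id.
Qed.

Lemma adj_M_comm i j k : i != j -> adj (M j) (M i k) = M i (adj (M j) k).
Proof.
rewrite eq_sym => ji.
exact (acts_at_comm tensP ji (blin_adjM j) (blin_M i) (@acts_at_adjM j)
  (@acts_at_M i) k).
Qed.

(** ** Tensor products of quotient modules *)

Section OfFactors.
Variable Qi : forall i, set (H i).
Arguments Qi : clear implicits.
Hypothesis quotQi : forall i : 'I_n, quotient_module1 (Qi i).

Let cQi (i : 'I_n) : closed_subspace (Qi i).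
Proof. by case: (quotQi i). Qed.

Let NQi (i : 'I_n) u : Qi i u -> Qi i (adj (Mz i) u).
Proof. by have /quotient_module1P[_] := quotQi i; apply. Qed.

Let NT j k : T Qi k -> T Qi (adj (M j) k).
Proof.
exact: (T_invariant (blin_adjM j) (@acts_at_adjM j) (@NQi j)).
Qed.

(** The compression of M_i acts on the [i]-th factor, the adjoint of M_j on the
    [j]-th one. *)
Lemma tensor_doubly_commuting : doubly_commuting M (T Qi).
Proof.
have cT : closed_subspace (T Qi) := closed_subspace_T tens Qi.
have proj_M (i : 'I_n) k : T Qi k ->
    proj (T Qi) (M i k) = proj (slab (Qi i)) (M i k).
  by apply: proj_T_acts (blin_M i) (acts_at_M i).
move=> i j ij x Qx /=.
have ij' : i != j by apply: contraTneq ij => ->; rewrite ltnn.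
rewrite !adjoint_on_compression //; try exact: blin_M; try exact: NT; last first.
  exact: proj_in.
rewrite /compression !proj_M //; last exact: NT.
rewrite -adj_M_comm //.
apply: (acts_at_comm tensP ij' (blin_proj (closed_slab _ _))
  (blin_adjM j) (proj_slab tensP (cQi i)) (@acts_at_adjM j)).
Qed.

Hypothesis stdH : forall i, standard (H i).

(** Fixing all coordinates but one, the vectors that keep the elementary tensor in
    the hull form an invariant subspace containing Q_i, which by standardness is
    everything. The coordinates in [J] are freed in this way one after the other. *)
Lemma hull_tensor (J : set 'I_n) : (forall i, J i -> ~ Qi i `<=` [set 0]) ->
  invariant_hull M J (T Qi) = T (fun i => if i \in J then setT else Qi i).
Proof.
move=> Qi0.
set W : forall i, set (H i) := fun i => if i \in J then setT else Qi i.
have bM := blin_M; pose hull := invariant_hull M J (T Qi).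
have ch : closed_subspace hull by exact: closed_hull.
apply/seteqP; split.
  apply: hull_min; first exact: closed_subspace_T.
    move=> i Ji; apply: (T_invariant (blin_M i) (@acts_at_M i)) => u.
    by rewrite /W (mem_set Ji).
  by apply: T_sub => i u; rewrite /W; case: ifP.
apply: T_min => // x Wx.
(* Only the coordinates in [J] of index below [m] may leave the Q_i. *)
suff key m y : (forall i, (i \in J) && (i < m)%N \/ Qi i (y i)) -> hull (tens y).
  apply: (key n) => i; rewrite ltn_ord andbT; have := Wx i; rewrite /W.
  by case: ifP => _; [left|right].
elim: m y => [|m IH] y yP.
  have Ty : T Qi (tens y).
    by apply: T_tens => i; case: (yP i) => //; rewrite ltn0 andbF.
  exact: (@hull_sub _ _ _ M J (T Qi)).
have [mn|nm] := ltnP m n; last first.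
  apply: IH => i; have [/andP[iJ _]|] := yP i; last by right.
  by left; rewrite iJ (leq_trans (ltn_ord i)).
have yP' i : i != Ordinal mn -> (i \in J) && (i < m)%N \/ Qi i (y i).
  move=> im; have [/andP[iJ]|] := yP i; last by right.
  rewrite ltnS leq_eqVlt -val_eqE /= in im *; rewrite (negPf im) /= => im'.
  by left; rewrite iJ.
have hsl u : Qi (Ordinal mn) u -> hull (slice y u).
  move=> Qu; apply: IH.
  apply: (@upd_prop _ _ (fun i v => (i \in J) && (i < m)%N \/ Qi i v)) => //.
  by right.
rewrite -(slice_id tens y (Ordinal mn)).
have [/andP[mJ _]|] := yP (Ordinal mn); last exact: hsl.
have Jm : J (Ordinal mn) by rewrite -inE.
suff Ut : [set u | hull (slice y u)] = [set: H (Ordinal mn)].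
  suff : [set u | hull (slice y u)] (y (Ordinal mn)) by [].
  by rewrite Ut.
have cU := closed_subspace_preim (@blin_slice _ _ _ _ _ tensP y (Ordinal mn)) ch.
have MU (u : H (Ordinal mn)) : hull (slice y u) -> hull (slice y (mulz u)).
  by move=> hu; rewrite -M_slice; exact: hull_invariant.
exact (standard_generates (@stdH (Ordinal mn)) (quotQi _) (Qi0 _ Jm) cU MU hsl).
Qed.

Lemma tensor_reducing (J : set 'I_n) :
  joint_reducing M J (invariant_hull M J (T Qi)).
Proof.
have [Qi0|] := pselect (forall i, J i -> ~ Qi i `<=` [set 0]); last first.
  move=> /existsNP[i /not_implyP[Ji /contrapT Qi0]].
  have -> : invariant_hull M J (T Qi) = [set 0].
    apply/seteqP; split; last first.
      by move=> _ ->; apply: subspace0; exact: closed_hull.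
    apply: hull_min; first exact: closed_subspace_set0.
      by move=> j _ _ ->; rewrite /= linear0.
    apply: T_min; first exact: closed_subspace_set0.
    by move=> x Qx; apply: (tens_eq0 tensP (i := i)); exact/Qi0/Qx.
  split; first exact: closed_subspace_set0.
  move=> j _; split=> _ [_ -> <-] /=; first by rewrite linear0.
  by rewrite adjoint_on_setT ?(lin0 (blin_adjM j).1) //; exact: blin_M.
rewrite hull_tensor //; split; first exact: closed_subspace_T.
move=> i Ji; split=> _ [k Tk <-].
  by apply: (T_invariant (blin_M i) (@acts_at_M i)) Tk => u; rewrite (mem_set Ji).
rewrite adjoint_on_setT; last exact: blin_M.
by apply: (T_invariant (blin_adjM i) (@acts_at_adjM i)) Tk => u; rewrite (mem_set Ji).
Qed.

End OfFactors.

(** ** Splitting a doubly commuting quotient module *)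

Section Splitting.
Variable Q : set K.
Hypotheses (quotQ : quotient_module M Q) (dcQ : doubly_commuting M Q).

Let cQ : closed_subspace Q.
Proof. by case: quotQ. Qed.

Let NQ i q : Q q -> Q (adj (M i) q).
Proof. by move: q; have /(quotient_moduleP blin_M)[_] := quotQ; apply. Qed.

Lemma quotient_support i : quotient_module1 (@support i Q).
Proof.
apply/quotient_module1P; split; first exact: closed_support.
suff MZ u : orthocomp (@support i Q) u -> orthocomp (@support i Q) (mulz u).
  move=> u Qu; rewrite -(orthocompK (@closed_support _ _ _ _ tens i Q)).
  apply: orthocomp_invariant MZ _ _; first exact: blin_mulz.
  by rewrite orthocompK //; exact: closed_support.
rewrite !orthocomp_support // => Zu x s Qs.
by rewrite -M_slice adjP; [apply: Zu; exact: NQ|exact: blin_M].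
Qed.

Lemma quotient_commute (i j : 'I_n) q : (i < j)%N -> Q q ->
  proj Q (M i (adj (M j) q)) = adj (M j) (proj Q (M i q)).
Proof.
move=> ij Qq; have := dcQ ij Qq; rewrite /= !adjoint_on_compression //;
  try exact: blin_M; try exact: NQ.
exact: proj_in.
Qed.

(** On [Q], the difference D of the compressions of M_i to the hull and to [Q]
    commutes with the adjoints of the M_j for j in [J], and its range is orthogonal
    to [Q]. So the range of D is orthogonal to the hull, in which it lies. *)
Lemma proj_hull_compression (J : set 'I_n) (i : 'I_n) q :
  (forall j : 'I_n, J j -> (i < j)%N) ->
  joint_reducing M J (invariant_hull M J Q) ->
  Q q -> proj (invariant_hull M J Q) (M i q) = proj Q (M i q).
Proof.
move=> iJ [cS redS] Qq; set S := invariant_hull M J Q in cS redS *.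
have QS : Q `<=` S by exact: hull_sub.
have MS j s : J j -> S s -> S (M j s) by exact: hull_invariant.
have NS j s : J j -> S s -> S (adj (M j) s).
  move=> Jj Ss; rewrite -adjoint_on_setT; last exact: blin_M.
  by apply: (redS j Jj).2; exists s.
pose D p := proj S (M i p) - proj Q (M i p).
have ND j p : J j -> Q p -> adj (M j) (D p) = D (adj (M j) p).
  move=> Jj Qp; have bN := blin_adjM j.
  have ij : i != j by apply: contraTneq (iJ j Jj) => ->; rewrite ltnn.
  rewrite (linB bN.1) -(proj_adj_comm _ (blin_M j) cS).
  - by rewrite adj_M_comm // -quotient_commute //; exact: iJ.
  - by move=> s; exact: MS.
  - by move=> s; exact: NS.
have SD p : S (D p).
  by apply: (subspaceB cS); [exact: proj_in|apply: QS; exact: proj_in].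
have sub : S `<=` [set s | S s /\ forall p, Q p -> inner s (D p) = 0].
  have cD := closed_subspaceI cS (closed_subspace_orthocomp (D @` Q)).
  have DE : S `&` orthocomp (D @` Q) =
      [set s | S s /\ forall p, Q p -> inner s (D p) = 0].
    apply/seteqP; split=> s [Ss sD]; split=> //.
      by move=> p Qp; apply: sD; exists p.
    by move=> _ [p Qp <-]; exact: sD.
  rewrite -DE; apply: hull_min => //; rewrite DE.
    move=> j Jj s [Ss sD]; split; first exact: MS.
    move=> p Qp; rewrite adjP; last exact: blin_M.
    by rewrite ND //; apply: sD; exact: NQ.
  move=> s Qs; split; first exact: QS.
  move=> p Qp; rewrite innerBr !inner_projr ?subrr //; exact: QS.
apply/eqP; rewrite -subr_eq0 -inner_eq0; apply/eqP.
by have [_] := sub _ (SD q); apply.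
Qed.

Hypothesis stdH : forall i, standard (H i).
Arguments stdH : clear implicits.
Hypothesis redQ : forall k : 'I_n,
  let from_k := [set j : 'I_n | (k <= j)%N] in
  joint_reducing M from_k (invariant_hull M from_k Q).

(** Let S be the hull of [Q] under the coordinates after i. It is regular in those
    factors by the Schur step, as it is reducing, and it inherits regularity in the
    factors before i from [Q]; hence it is a product, whose [i]-th factor is the
    support of [Q]. Compressing M_i to that support is then the same as compressing
    it to S, and by [proj_hull_compression] to [Q]: the Schur step applies to [Q]. *)
Lemma regular_support_step (i : 'I_n) : (i.+1 < n)%N ->
  (forall j : 'I_n, (j < i)%N -> regular Q (@support j Q)) ->
  regular Q (@support i Q).
Proof.
move=> i1n reg; pose J := [set j : 'I_n | (i.+1 <= j)%N].
have redS : joint_reducing M J (invariant_hull M J Q) := redQ (Ordinal i1n).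
have [cS redJ] := redS; set S := invariant_hull M J Q in cS redS redJ.
have QS : Q `<=` S by exact: hull_sub.
have MS j s : J j -> S s -> S (M j s) by exact: hull_invariant.
have NS j s : J j -> S s -> S (adj (M j) s).
  move=> Jj Ss; rewrite -adjoint_on_setT; last exact: blin_M.
  by apply: (redJ j Jj).2; exists s.
pose W j : set (H j) := if (j <= i)%N then @support j Q else setT.
have cW j : closed_subspace (W j).
  by rewrite /W; case: ifP => _; [exact: closed_support|exact: closed_subspaceT].
have Wi : W i = @support i Q by rewrite /W leqnn.
have SE : S = T W.
  apply: (tensor_of_regular tensP (i := i)) => // [j|j ji|].
  - rewrite /W; case: leqP => [ji|_]; last by rewrite slab_setT.
    apply: hull_min; first exact: closed_slab.
      move=> l Jl; apply: (T_invariant (blin_M l) (@acts_at_M l)) => u.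
      have jl : j != l by apply: contraTneq Jl => <-; rewrite /J /= -leqNgt.
      by rewrite dfwith_out.
    exact: (sub_slab_support tensP).
  - rewrite /W; case: leqP => [lji|ij].
      have {}ji : (j < i)%N by rewrite ltn_neqAle lji andbT.
      move=> w Ww; have cE : closed_subspace (slab (line w)) by exact: closed_slab.
      have bE := blin_proj cE.
      apply: hull_min; first exact: (closed_subspace_preim bE cS).
        move=> l Jl s Es.
        have jl : j != l.
          by apply: contraTneq Jl => <-; rewrite /J /= -leqNgt ltnW.
        rewrite /= (acts_at_comm tensP jl bE (blin_M l)
          (proj_slab tensP (@closed_line _ _ _ j w)) (@acts_at_M l)).
        exact: MS.
      by move=> q Qq; apply: QS; exact: (reg j ji).
    apply: (regular_of_reducing tensP (blin_mulz (H j)) (blin_M j) (@acts_at_M j)).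
    + exact: closed_subspaceT.
    + by [].
    + exact: standard_irreducible (stdH j) _.
    + by [].
    + by rewrite slab_setT.
    + by move=> s; exact: NS.
    + by move=> s Ss; rewrite slab_setT // proj_id //; exact: MS.
  - rewrite Wi => u uQ v vS; apply: uQ => x s Qs; apply: vS; exact: QS.
apply: (regular_of_reducing tensP (blin_mulz (H i)) (blin_M i) (@acts_at_M i)).
- exact: closed_support.
- by have /quotient_module1P[] := quotient_support i.
- exact: standard_irreducible (stdH i) _.
- by [].
- exact: (sub_slab_support tensP).
- by move=> q; exact: NQ.
move=> q Qq; have Tq : T W q by rewrite -SE; exact: QS.
rewrite -Wi -(proj_T_acts cW (blin_M i) (@acts_at_M i) Tq) -SE.
rewrite proj_hull_compression //; exact: proj_in.
Qed.

Theorem tensor_of_supports : (0 < n)%N -> Q = T (fun i => @support i Q).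
Proof.
move=> n0; have ln : (n.-1 < n)%N by rewrite ltn_predL.
have reg m (i : 'I_n) : (i < m)%N -> (i.+1 < n)%N -> regular Q (@support i Q).
  elim: m i => // m IH i im i1n; apply: regular_support_step => // j ji.
  by apply: IH; [exact: leq_trans ji im|exact: leq_trans (ltnW i1n)].
apply: (tensor_of_regular tensP (i := Ordinal ln)) => // [j|j|j jn].
- exact: closed_support.
- exact: (sub_slab_support tensP).
apply: (reg j.+1) => //; rewrite ltn_neqAle ltn_ord andbT.
by apply: contra_neq jn => jn; apply: val_inj; exact: (congr1 predn jn).
Qed.

End Splitting.

End ModuleTensor.

Theorem theorem4p4 (R : realType) (n : nat) (n_ge2 : (2 <= n)%N)
    (H : 'I_n -> rkHilbertModuleType R) (stdH : forall i, standard (H i))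
    (K : hilbertType R) (tens : (forall i, H i) -> K)
    (M : 'I_n -> {linear K -> K}) (KM : hilbert_module_tensor tens M)
    (Q : set K) (quotQ : quotient_module M Q) :
  (exists Qi : forall i, set (H i),
      (forall i, quotient_module1 (Qi i)) /\
      Q = tensor_subspace tens Qi)
  <->
  (doubly_commuting M Q /\
   forall k : 'I_n,
     let from_k := [set j : 'I_n | (k <= j)%N] in
     joint_reducing M from_k (invariant_hull M from_k Q)).
Proof.
have n_gt0 : (0 < n)%N by exact: ltnW.
split=> [[Qi [quotQi QE]]|[dcQ redQ]].
  rewrite QE; split; first exact (tensor_doubly_commuting KM quotQi).
  by move=> k from_k; exact (tensor_reducing KM quotQi stdH from_k).
exists (fun i => @support _ _ _ _ tens i Q); split.
  by move=> i; exact: (quotient_support KM).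
exact: (tensor_of_supports KM).
Qed.
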